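(* Let $n \geq 1$ and $1 \leq s \leq 30$ be integers, and let $$g_1(x) = g_1(x,n,s) = n!\sum_{j=0}^{n} \binom{n+s-j}{n-j}\frac{x^j}{j!}.$$ If $g_1(x)$ is reducible, then $$(n,s) \in \{(786600,25), (786600,26)\}.$$
   Context: Reducibility is understood over $\mathbb{Q}$ (equivalently over $\mathbb{Z}$, since $g_1(x) \in \mathbb{Z}[x]$ is monic). One has $g_1(x) = n!\,(-1)^n L_n^{(-n-s-1)}(x)$, where $L_n^{(\alpha)}(x) = \sum_{j=0}^{n} \frac{(\alpha+n)\cdots(\alpha+j+1)}{(n-j)!}\frac{(-x)^j}{j!}$ is the generalised Laguerre polynomial of degree $n$. *)

(* Defs.v *)
From mathcomp Require Import all_boot all_order all_algebra.
Set Implicit Arguments.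
Unset Strict Implicit.
Unset Printing Implicit Defensive.
Import GRing.Theory.
Local Open Scope ring_scope.

(* The coefficients are integers, but g1 is taken with rational coefficients
   because its reducibility is understood over Q. Since g1 n s has degree n,
   for 1 <= n it is reducible over Q exactly when it is not irreducible_poly
   (which, over a field, also fails on constants). The nat subtractions are
   exact, as j <= n. *)
Definition g1 (n s : nat) : {poly rat} :=
  (n`!)%:R *:
    \sum_(j < n.+1) ('C(n + s - j, n - j)%:R *: ((j`!)%:R^-1 *: 'X^j)).

(* Main.v *)
(** For a prime [p] not dividing ['C(n + s, s)], the [p]-adic Newton polygon of
    [g1 n s] is that of the truncated exponential: its vertices are the
    truncations [p ^ i * (n %/ p ^ i)] of the base [p] expansion of [n], and the
    slopes have powers of [p] as denominators. Hence the degree [k] of a factor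
    satisfies [k %% p ^ t <= n %% p ^ t] for all [t], that is, [p] does not
    divide ['C(n, k)]. So all primes dividing ['C(n, k)] divide ['C(n + s, s)],
    and in particular they are smaller than [k + s]; when [30 < k <= n / 2]
    this contradicts estimates in the style of Erdos's proof of the theorem of
    Sylvester and Schur. When [k <= 30], the prime powers exactly dividing [n]
    are at most [30], which leaves finitely many [n]. These are settled by the
    same criterion, by complete Newton polygons at well-chosen primes, and, for
    linear factors and even [n], by the positivity of
    [s! * g1(x) = int_0^oo (x + t) ^ n * t ^ s * exp (- t) dt]. The latter
    applies to [n = 786600], so that [g1 n s] is in fact never reducible. *)

From Stdlib Require Import NArith.
Require Import Defs.
From mathcomp Require Import all_boot all_order all_algebra.
From mathcomp Require Import zify ring.
Set Implicit Arguments.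
Unset Strict Implicit.
Unset Printing Implicit Defensive.
Import Order.TTheory GRing.Theory Num.Theory.

(** * Edges of Newton polygons *)

(** The obstacle is the shift by [s]: the primes dividing ['C(n, k)] are only bounded by [k + s],
    and for [k] just above 30 this nearly doubles their range. Comparing [(n / k) ^ k <= 'C(n, k)]
    with [n ^ prime_pi (k + s)] then works only for large [n], whereas only [2 * k <= n] is known.
    For smaller [n], one prime [p] with [n - k < p <= n] and [n - p + 30 < p] excludes [k] at once,
    because [n %% p = n - p < k = k %% p]; hence the tables of primes, whose spacing grows with [k].
    For [k <= 30] there remain 7680 values of [n], which are examined by computation with binary
    numbers. *)

Section NewtonEdges.

Variable p : nat.
Hypothesis p_pr : prime p.

(** The disjunct [x = 0] stands for the infinite valuation of zero, since [logn p 0] is [0]. *)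
Lemma pfactor_dvdzE m (x : int) :
  (Posz (p ^ m) %| x)%Z <-> x = 0 \/ m <= logn p `|x|.
Proof.
rewrite dvdzE /=; case: (eqVneq x 0) => [->|x0]; first by rewrite dvdn0; split=> // _; left.
rewrite pfactor_dvdn ?absz_gt0 //; split; [by right|case=> // x_eq0].
by rewrite x_eq0 eqxx in x0.
Qed.

Lemma logn_absz_sum (I : Type) (r : seq I) (P : pred I) (F : I -> int) m :
    (forall i, P i -> F i = 0 \/ m <= logn p `|F i|) ->
  let S := (\sum_(i <- r | P i) F i)%R in S = 0 \/ m <= logn p `|S|.
Proof.
move=> HF; apply/pfactor_dvdzE.
by apply: (big_ind (fun x => is_true (dvdz _ x)));
  [exact: dvdz0 | exact: rpredD | move=> i /HF/pfactor_dvdzE].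
Qed.

Lemma logn_abszDl (x y : int) :
    x != 0 -> (y = 0 \/ logn p `|x| < logn p `|y|) ->
  (x + y != 0)%R /\ logn p `|(x + y)%R| = logn p `|x|.
Proof.
move=> x0 /pfactor_dvdzE; set v := logn p _ => dvy.
have dvx : (Posz (p ^ v) %| x)%Z by apply/pfactor_dvdzE; right.
have Ndvx : ~~ (Posz (p ^ v.+1) %| x)%Z.
  by apply/negP => /pfactor_dvdzE[x_eq0|]; [rewrite x_eq0 eqxx in x0|rewrite ltnn].
have Ndvxy : ~~ (Posz (p ^ v.+1) %| (x + y)%R)%Z by rewrite rpredDr.
have dvxy : (Posz (p ^ v) %| (x + y)%R)%Z.
  rewrite rpredD // (dvdz_trans _ dvy) // dvdzE /= dvdn_exp2l //.
have xy0 : (x + y != 0)%R by apply: contraNneq Ndvxy => ->; rewrite dvdz0.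
split=> //; apply/eqP; rewrite eqn_leq leqNgt.
move: dvxy => /pfactor_dvdzE[/eqP|->]; first by rewrite (negPf xy0).
by rewrite andbT; apply: contra Ndvxy => ?; apply/pfactor_dvdzE; right.
Qed.

(** This is [q] times the height at abscissa 0 of the line of slope [- u / q] through the point of
    index [j]; the factor [q] keeps it in [nat]. *)
Definition wt q u (f : {poly int}) j := q * logn p `|(f`_j)%R| + u * j.

(* With [before := ltn] (resp. [gtn]), [x] is the abscissa of the left (resp.
   right) end of the edge of slope [- u / q] of the [p]-adic Newton polygon of
   [f]; a degenerate edge is a single vertex. *)
Definition edge_end (before : rel nat) q u (f : {poly int}) x :=
  (f`_x)%R != 0 /\
  forall j, (f`_j)%R != 0 -> wt q u f x + before j x <= wt q u f j.

Notation edge_start := (edge_end ltn).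
Notation edge_stop := (edge_end gtn).

(** Weights add up in products. The two hypotheses on [before] say that any other pair of indices
    with sum [x + y], or with a sum before it, has a member on the side where the weight is strictly
    larger; so no cancellation occurs at [x + y]. They hold for both [ltn] and [gtn]. *)
Lemma edge_endM before q u (f g : {poly int}) x y :
    0 < q ->
    (forall i i' : nat, i + i' = x + y -> i != x -> before i x || before i' y) ->
    (forall i i' : nat,
       before (i + i') (x + y) -> before i x || before i' y) ->
  edge_end before q u f x -> edge_end before q u g y ->
  edge_end before q u (f * g)%R (x + y).
Proof.
move=> q0 Heq Hbef [fx0 Hf] [gy0 Hg].
pose W := wt q u f x + wt q u g y.
(* The quotient is the ceiling of [(m - u * (i + i')) / q]: a bound on the weight becomes one on the
   valuation. Where the subtraction truncates, the quotient is [0]. *)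
have term i i' m : W + (before i x + before i' y) >= m ->
    ((f`_i * g`_i')%R = 0) \/ ((m - u * (i + i') + q.-1) %/ q <= logn p `|(f`_i * g`_i')%R|).
  move=> hm; case: (eqVneq (f`_i * g`_i')%R 0) => [->|]; first by left.
  rewrite mulf_eq0 negb_or => /andP[fi0 gi0]; right.
  rewrite abszM lognM ?absz_gt0 // -ltnS ltn_divLR //.
  by have := Hf _ fi0; have := Hg _ gi0; move: hm; rewrite /W /wt; nia.
have main : wt q u f x + wt q u g y =
    q * logn p `|(f`_x * g`_y)%R| + u * (x + y).
  by rewrite /wt abszM lognM ?absz_gt0 //; lia.
have fgxy0 : (f`_x * g`_y)%R != 0 by rewrite mulf_neq0.
have [fg0 fgE] : ((f * g)`_(x + y))%R != 0 /\
    logn p `|((f * g)`_(x + y))%R| = logn p `|(f`_x * g`_y)%R|.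
  have xlt : x < (x + y).+1 by rewrite ltnS leq_addr.
  rewrite coefM (bigD1 (Ordinal xlt)) //= addKn.
  apply: logn_abszDl => //.
  have := @logn_absz_sum _ (index_enum _) (fun i : 'I_(x + y).+1 => i != Ordinal xlt)
    (fun i => (f`_i * g`_(x + y - i))%R) ((W.+1 - u * (x + y) + q.-1) %/ q).
  case=> [i ix||hle]; [|by left|right; apply: leq_trans hle].
    have ie : i + (x + y - i) = x + y by rewrite subnKC // -ltnS.
    have := term i (x + y - i) W.+1; rewrite ie; apply.
    have := Heq i (x + y - i) ie ix.
    by case: (before i x); case: (before _ y) => //= _; rewrite /W; lia.
  rewrite leq_divRL // /W main; clear -q0.
  by move: (logn _ _) (u * _) => l A; rewrite mulSn mulnC; lia.
have Wxy : wt q u (f * g)%R (x + y) = W by rewrite /W main /wt fgE.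
split=> // j; rewrite Wxy /wt coefM => fgj0.
have := @logn_absz_sum _ (index_enum _) xpredT
    (fun i : 'I_j.+1 => (f`_i * g`_(j - i))%R)
    ((W + before j (x + y) - u * j + q.-1) %/ q).
case=> [i _|/eqP|]; [|by rewrite (negPf fgj0)|].
  have ie : i + (j - i) = j by rewrite subnKC // -ltnS.
  have := term i (j - i) (W + before j (x + y)); rewrite ie; apply.
  have := Hbef i (j - i); rewrite ie.
  case: (before j _); last by lia.
  by move=> /(_ isT); case: (before i x); case: (before _ y) => //=; lia.
rewrite -ltnS ltn_divLR // mulSn mulnC; clear -q0.
by move: (logn _ _) (u * j) (W + _) => l A B; lia.
Qed.

Lemma edge_startM q u f g x y : 0 < q ->
  edge_start q u f x -> edge_start q u g y -> edge_start q u (f * g)%R (x + y).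
Proof. by move=> q0; apply: edge_endM => // i i'; rewrite /ltn /=; lia. Qed.

Lemma edge_stopM q u f g x y : 0 < q ->
  edge_stop q u f x -> edge_stop q u g y -> edge_stop q u (f * g)%R (x + y).
Proof. by move=> q0; apply: edge_endM => // i i'; rewrite /gtn /ltn /=; lia. Qed.

Lemma edge_start_uniq q u f x y :
  edge_start q u f x -> edge_start q u f y -> x = y.
Proof.
move=> [fx hx] [fy hy]; have := hx _ fy; have := hy _ fx; rewrite /ltn /=; lia.
Qed.

Lemma edge_stop_uniq q u f x y :
  edge_stop q u f x -> edge_stop q u f y -> x = y.
Proof.
move=> [fx hx] [fy hy]; have := hx _ fy; have := hy _ fx; rewrite /gtn /ltn /=; lia.
Qed.

(** A pair read as a number in base [N.+1] is ordered lexicographically, so minimising one natural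
    number selects the least weight and, among ties, the outermost index. *)
Lemma lex_key_leq N A B a b : b <= N ->
  A * N.+1 + a <= B * N.+1 + b -> A + (b < a) <= B.
Proof.
move=> bN h; have : A < B \/ A = B \/ B.+1 <= A by lia.
case=> [AB|[AB|BA]].
- by case: (b < a); lia.
- by move: h; rewrite AB leq_add2l leqNgt => /negPf->; rewrite addn0.
by have := leq_mul BA (leqnn N.+1); rewrite mulSn; lia.
Qed.

Lemma edge_start_exists q u f : f != 0%R -> exists x, edge_start q u f x.
Proof.
move=> f0; have lt : (size f).-1 < size f by rewrite ltn_predL size_poly_gt0.
have P0 : (f`_(Ordinal lt))%R != 0 by rewrite /= -lead_coefE lead_coef_eq0.
pose key (i : 'I_(size f)) := wt q u f i * (size f).+1 + i.
case: (@arg_minnP _ (Ordinal lt) (fun i : 'I__ => (f`_i)%R != 0) key P0) => x fx hx.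
exists x; split=> // j fj.
have jlt : j < size f by rewrite ltnNge; apply: contra fj => ?; rewrite nth_default.
by apply: lex_key_leq (hx (Ordinal jlt) fj); apply: ltnW.
Qed.

Lemma edge_stop_exists q u f : f != 0%R -> exists x, edge_stop q u f x.
Proof.
move=> f0; have lt : (size f).-1 < size f by rewrite ltn_predL size_poly_gt0.
have P0 : (f`_(Ordinal lt))%R != 0 by rewrite /= -lead_coefE lead_coef_eq0.
pose key (i : 'I_(size f)) := wt q u f i * (size f).+1 + (size f - i).
case: (@arg_minnP _ (Ordinal lt) (fun i : 'I__ => (f`_i)%R != 0) key P0) => x fx hx.
exists x; split=> // j fj.
have jlt : j < size f by rewrite ltnNge; apply: contra fj => ?; rewrite nth_default.
have := lex_key_leq (leq_subr j (size f)) (hx (Ordinal jlt) fj).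
by rewrite ltn_sub2lE // ltnW.
Qed.

(** Both ends have the minimal weight, so [u * (y - x)] is a multiple of [q]. *)
Lemma edge_dvdn q u f x y : coprime u q ->
  edge_start q u f x -> edge_stop q u f y -> x <= y /\ q %| y - x.
Proof.
move=> cuq [fx hx] [fy hy]; have := hx _ fy; have := hy _ fx.
rewrite /gtn /ltn /= => h1 h2.
have xy : x <= y by lia.
split=> //; rewrite -(@Gauss_dvdr q u) 1?coprime_sym //.
have e : wt q u f x = wt q u f y by lia.
have : q * logn p `|(f`_y)%R| + u * (y - x) = q * logn p `|(f`_x)%R|.
  by move: e; rewrite /wt mulnBr; have := leq_mul (leqnn u) xy; lia.
by move=> e'; rewrite -(dvdn_addr _ (dvdn_mulr (logn p `|(f`_y)%R|) (dvdnn q))) e' dvdn_mulr.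
Qed.

(** Convexity: the steeper descending edge lies to the left. If [y < x], the two minimality
    conditions contradict the order of the slopes. *)
Lemma edge_stop_le_start q1 u1 q2 u2 f x y : u2 * q1 < u1 * q2 ->
  edge_stop q1 u1 f x -> edge_start q2 u2 f y -> x <= y.
Proof.
move=> slope [fx hx] [fy hy]; rewrite leqNgt; apply/negP => yx.
have := hx _ fy; have := hy _ fx; rewrite /wt /gtn /ltn /= ltnNge (ltnW yx) !addn0.
move=> /(leq_mul (leqnn q1)) h1 /(leq_mul (leqnn q2)) h2.
have [d xE] : exists d, x = y + d.+1 by exists (x - y).-1; lia.
have h3 := leq_mul slope (leqnn d.+1).
move: (logn _ _) (logn _ _) h1 h2 => a b; rewrite xE; clear -h3; nia.
Qed.

(** A slope strictly between those of two adjacent edges of the product occurs in neither factor: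
    the ends satisfy [a <= b] and [a' <= b'], and both sums equal [z]. *)
Lemma edge_glue q1 u1 q2 u2 f g z a b : 0 < q1 -> 0 < q2 -> u2 * q1 < u1 * q2 ->
    (f != 0)%R -> (g != 0)%R ->
    edge_stop q1 u1 (f * g)%R z -> edge_start q2 u2 (f * g)%R z ->
  edge_stop q1 u1 f a -> edge_start q2 u2 f b -> a = b.
Proof.
move=> q10 q20 sl f0 g0 fg1 fg2 fa fb.
have [a' ga] := edge_stop_exists q1 u1 g0.
have [b' gb] := edge_start_exists q2 u2 g0.
have e1 := edge_stop_uniq fg1 (edge_stopM q10 fa ga).
have e2 := edge_start_uniq fg2 (edge_startM q20 fb gb).
have := edge_stop_le_start sl fa fb; have := edge_stop_le_start sl ga gb; lia.
Qed.

(* A list of triples [(u, q, z)]: consecutive edges, of slope [- u / q], the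
   edge ending at abscissa [z]. *)
Fixpoint newton (f : {poly int}) x (es : seq (nat * nat * nat)) : Prop :=
  if es is (u, q, z) :: es' then
    [/\ 0 < q /\ coprime u q, edge_start q u f x, edge_stop q u f z,
        if es' is (u', q', _) :: _ then u' * q < u * q' else true &
        newton f z es']
  else x = (size f).-1.

(** Dumas's description of the degrees of factors: a factor takes from each edge a piece whose
    horizontal length is a multiple of [q]. *)
Fixpoint reach (es : seq (nat * nat * nat)) x a k : Prop :=
  if es is (u, q, z) :: es' then
    exists2 t, t * q <= z - x & reach es' z (a + t * q) k
  else a = k.

Lemma edge_end_le_deg before q u (f : {poly int}) x :
  edge_end before q u f x -> x <= (size f).-1.
Proof.
case=> fx _; have : x < size f by rewrite ltnNge; apply: contra fx => ?; rewrite nth_default.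
lia.
Qed.

Lemma newton_reach (f g : {poly int}) x u q z es a : (f != 0)%R -> (g != 0)%R ->
    newton (f * g)%R x ((u, q, z) :: es) -> edge_start q u f a ->
  reach ((u, q, z) :: es) x a (size f).-1.
Proof.
move=> f0 g0; elim: es x u q z a => [|[[u' q'] z'] es IH] x u q z a.
  case=> -[q0 cuq] fgx fgz _ /= zE fa.
  have [b fb] := edge_stop_exists q u f0.
  have [a' ga] := edge_start_exists q u g0.
  have [b' gb] := edge_stop_exists q u g0.
  have e1 := edge_start_uniq fgx (edge_startM q0 fa ga).
  have e2 := edge_stop_uniq fgz (edge_stopM q0 fb gb).
  have [ab /dvdnP[t tE]] := edge_dvdn cuq fa fb.
  have [ab' _] := edge_dvdn cuq ga gb.
  exists t; first by rewrite -tE; clear -e1 e2 ab ab'; lia.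
  have szf : 0 < size f by rewrite size_poly_gt0.
  have szg : 0 < size g by rewrite size_poly_gt0.
  have szM : size (f * g)%R = (size f + size g).-1 by exact: size_mul.
  move: zE; rewrite szM -tE subnKC // => zE.
  have hb : b <= (size f).-1 by exact: edge_end_le_deg fb.
  have hb' : b' <= (size g).-1 by exact: edge_end_le_deg gb.
  (* The last edge ends at the degree of the product, so both factors reach their own degree. *)
  have bE : b = (size f).-1 by clear -szf szg zE e2 hb hb'; lia.
  by rewrite bE.
case=> -[q0 cuq] fgx fgz sl nw fa.
have [b fb] := edge_stop_exists q u f0.
have [a' ga] := edge_start_exists q u g0.
have [b' gb] := edge_stop_exists q u g0.
have e1 := edge_start_uniq fgx (edge_startM q0 fa ga).
have e2 := edge_stop_uniq fgz (edge_stopM q0 fb gb).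
have [ab /dvdnP[t tE]] := edge_dvdn cuq fa fb.
have [ab' _] := edge_dvdn cuq ga gb.
exists t; first by lia.
have abE : a + t * q = b by lia.
rewrite abE.
have [[q0' _] fgz' _ _ _] := nw.
have [c fc] := edge_start_exists q' u' f0.
rewrite (edge_glue q0 q0' sl f0 g0 fgz fgz' fb fc).
exact: IH nw fc.
Qed.

Lemma newton_factor_deg (f g : {poly int}) u q z es : (f * g != 0)%R ->
  newton (f * g)%R 0 ((u, q, z) :: es) ->
  reach ((u, q, z) :: es) 0 0 (size f).-1.
Proof.
rewrite mulf_eq0 negb_or => /andP[f0 g0] nw.
have [a fa] := edge_start_exists q u f0.
have [a' ga] := edge_start_exists q u g0.
have [[q0 _] fg0 _ _ _] := nw.
have := edge_start_uniq fg0 (edge_startM q0 fa ga).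
case: a fa => // fa _; exact: newton_reach nw fa.
Qed.

End NewtonEdges.
Notation edge_start p := (edge_end p ltn).
Notation edge_stop p := (edge_end p gtn).

(** * Newton polygons at the primes not dividing the binomial coefficient *)

(** The free upper limit [B] allows the Legendre sums of several factorials to be merged. *)
Lemma logn_fact_bound p m B : prime p -> m < B ->
  logn p m`! = \sum_(1 <= t < B) m %/ p ^ t.
Proof.
move=> p_pr mB; rewrite logn_fact // [RHS](big_cat_nat _ (n := m.+1)) //=.
rewrite [X in _ + X]big_nat [X in _ + X]big1 ?addn0 // => t /andP[mt _].
rewrite divn_small //.
exact: leq_trans mt (ltnW (ltn_expl _ (prime_gt1 p_pr))).
Qed.

Lemma logn_bin p a b B : prime p -> a + b < B ->
  logn p 'C(a + b, b) = \sum_(1 <= t < B) (p ^ t <= a %% p ^ t + b %% p ^ t).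
Proof.
move=> p_pr abB; have := bin_fact (leq_addl a b); rewrite addnK => /(congr1 (logn p)).
rewrite !lognM ?muln_gt0 ?fact_gt0 ?bin_gt0 ?leq_addl //.
rewrite !(@logn_fact_bound p _ B) //; try lia.
under [X in _ = X]eq_bigr => t _ do
  rewrite divnD ?expn_gt0 ?prime_gt0 //.
rewrite !big_split /=; lia.
Qed.

(* By Kummer's theorem, [p] does not divide ['C(a + b, b)]. *)
Definition nocarry p a b := forall t, a %% p ^ t + b %% p ^ t < p ^ t.

Lemma logn_bin_eq0 p a b : prime p -> logn p 'C(a + b, b) = 0 <-> nocarry p a b.
Proof.
move=> p_pr; rewrite (@logn_bin p a b (a + b).+1) //; split=> [/eqP|nc]; last first.
  by rewrite big1 // => t _; rewrite leqNgt nc.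
rewrite sum_nat_seq_eq0 => /allP h t.
case: (ltnP t (a + b).+1) => [tab|abt]; last first.
  have : a + b < p ^ t by apply: leq_trans abt (ltnW (ltn_expl _ (prime_gt1 p_pr))).
  by move=> abp; rewrite !modn_small //; lia.
case: (posnP t) => [->|t0]; first by rewrite !modn1.
have := h t; rewrite mem_index_iota t0 tab eqb0 -ltnNge => /(_ isT); exact.
Qed.

(* The coefficient of [x ^ j] in [g1 n s]. *)
Definition acoef n s j := 'C(n, j) * (n + s - j) ^_ (n - j).

Lemma acoef_fact n s j : j <= n -> acoef n s j * j`! = n`! * 'C(n - j + s, s).
Proof.
move=> jn; rewrite -(bin_fact jn) /acoef -bin_ffact.
rewrite -addnBAC // -[in RHS](bin_sub (leq_addl _ _)) addnK; lia.
Qed.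

Lemma acoef_gt0 n s j : j <= n -> 0 < acoef n s j.
Proof. by move=> jn; rewrite muln_gt0 bin_gt0 jn ffact_gt0; lia. Qed.

(** The binomial term can only raise the points above those of the truncated exponential; a vertex
    survives where this term vanishes. *)
Lemma logn_acoef p n s j : prime p -> j <= n ->
  logn p (acoef n s j) + logn p j`! = logn p n`! + logn p 'C(n - j + s, s).
Proof.
move=> p_pr jn; rewrite -!lognM ?acoef_gt0 ?fact_gt0 ?bin_gt0 ?leq_addl //.
by rewrite acoef_fact.
Qed.

Definition gpoly n s : {poly int} := \poly_(j < n.+1) Posz (acoef n s j).

Lemma coef_gpoly n s j : j <= n -> ((gpoly n s)`_j)%R = acoef n s j.
Proof. by move=> jn; rewrite coef_poly ltnS jn. Qed.

Lemma coef_gpoly_neq0 n s j : (((gpoly n s)`_j)%R != 0) = (j <= n).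
Proof.
rewrite coef_poly ltnS; case: ifP => jn; last by rewrite eqxx.
by rewrite eqz_nat -lt0n acoef_gt0.
Qed.

Lemma size_gpoly n s : size (gpoly n s) = n.+1.
Proof.
rewrite /gpoly size_poly_eq // eqz_nat -lt0n acoef_gt0 //.
Qed.

Lemma edge_end_gpoly p (before : rel nat) q u n s x : x <= n ->
  (forall j, j <= n -> q * logn p (acoef n s x) + u * x + before j x <=
                       q * logn p (acoef n s j) + u * j) ->
  edge_end p before q u (gpoly n s) x.
Proof.
move=> xn H; split; first by rewrite coef_gpoly_neq0.
move=> j; rewrite coef_gpoly_neq0 => jn.
by rewrite /wt !coef_gpoly // !absz_nat; apply: H.
Qed.

Section Digits.
Variables p : nat.
Hypothesis p_pr : prime p.

(** In closed form [(p ^ i - 1) / (p - 1)], the [p]-adic valuation of the factorial of [p ^ i]. *)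
Fixpoint repunit i := if i is i'.+1 then p * repunit i' + 1 else 0.

Lemma repunitS i : repunit i.+1 = repunit i + p ^ i.
Proof. elim: i => [|i IH]; first by rewrite /= expn0 muln0.
by rewrite -[RHS]/(p * _ + 1 + _) expnS -addnAC -mulnDr -IH.
Qed.

Lemma logn_fact_div m : logn p m`! = m %/ p + logn p (m %/ p)`!.
Proof.
have lt : m %/ p < m.+1 by rewrite ltnS leq_div.
rewrite (@logn_fact_bound p m m.+2) // (@logn_fact_bound p (m %/ p) m.+1) //.
rewrite big_ltn // expn1 big_add1; congr (_ + _).
by apply: eq_bigr => t _; rewrite -divnMA expnS.
Qed.

Lemma logn_fact_leq m m' : m <= m' -> logn p m`! <= logn p m'`!.
Proof.
move=> h; rewrite !(@logn_fact_bound p _ m'.+1) ?ltnS //.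
by apply: leq_sum => t _; apply: leq_div2r.
Qed.

(* The next two lemmas describe the edge of slope [- repunit i / p ^ i] of the
   truncated exponential [\sum_(j <= n) n! / j! * x ^ j]; they follow by induction
   on [i] from [logn p m! = m %/ p + logn p (m %/ p)!]. *)
Lemma fact_edge_stop i n j : j <= n ->
  repunit i * (p ^ i * (n %/ p ^ i)) + p ^ i * logn p j`! + (p ^ i * (n %/ p ^ i) < j)
  <= repunit i * j + p ^ i * logn p (p ^ i * (n %/ p ^ i))`!.
Proof.
have p0 := prime_gt0 p_pr.
elim: i n j => [|i IH] n j jn.
  by rewrite expn0 !mul1n divn1 ltnNge jn /= addn0 logn_fact_leq.
have hiE : p ^ i.+1 * (n %/ p ^ i.+1) = p * (p ^ i * (n %/ p %/ p ^ i)).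
  by rewrite -divnMA expnS mulnA.
move: {IH} (IH (n %/ p) (j %/ p) (leq_div2r _ jn)); rewrite hiE.
move: (p ^ i * _) => H; rewrite (logn_fact_div j) (logn_fact_div (p * H)) mulKn //.
rewrite repunitS expnS (divn_eq j p); have := ltn_pmod j p0.
move: (j %/ p) (j %% p) (repunit i) (p ^ i) (expn_gt0 p i) => J r R P.
rewrite p0 divnMDl // => P0 rp; rewrite (divn_small rp) addn0.
move: (logn _ J`!) (logn _ H`!) => LJ LH /(leq_mul (leqnn p)).
case: (ltnP H J) => HJ.
  by have := leq_b1 (p * H < J * p + r); nia.
have [] : (p * H < J * p + r) = false \/ 0 < r by nia.
  by move=> ->; nia.
by have := leq_b1 (p * H < J * p + r); nia.
Qed.

Lemma fact_edge_start i n j : j <= n ->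
  let x := p ^ i.+1 * (n %/ p ^ i.+1) in
  repunit i * x + p ^ i * logn p j`! + (j < x) <= repunit i * j + p ^ i * logn p x`!.
Proof.
have p0 := prime_gt0 p_pr.
elim: i n j => [|i IH] n j jn /=.
  rewrite expn1 expn0 !mul1n !add0n; case: (ltnP j (p * (n %/ p))) => h.
    rewrite (logn_fact_div j) (logn_fact_div (p * _)) mulKn // addn1.
    have lt : j %/ p < n %/ p by rewrite ltn_divLR // mulnC.
    by rewrite -addSn leq_add // logn_fact_leq // ltnW.
  rewrite addn0 (logn_fact_div j) (logn_fact_div (p * _)) mulKn //.
  by rewrite leq_add ?logn_fact_leq ?leq_div2r.
have hiE : p ^ i.+2 * (n %/ p ^ i.+2) = p * (p ^ i.+1 * (n %/ p %/ p ^ i.+1)).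
  by rewrite -divnMA expnS mulnA.
move: {IH} (IH (n %/ p) (j %/ p) (leq_div2r _ jn)); rewrite hiE /=.
move: (p ^ i.+1 * _) => H; rewrite (logn_fact_div j) (logn_fact_div (p * H)) mulKn //.
rewrite -/(repunit i.+1) repunitS expnS (divn_eq j p); have := ltn_pmod j p0.
move: (j %/ p) (j %% p) (repunit i) (p ^ i) (expn_gt0 p i) => J r R P.
rewrite p0 divnMDl // => P0 rp; rewrite (divn_small rp) addn0.
move: (logn _ J`!) (logn _ H`!) => LJ LH /(leq_mul (leqnn p)).
case: (ltnP J H) => HJ.
  by have := leq_b1 (J * p + r < p * H); nia.
have -> : (J * p + r < p * H) = false by nia.
nia.
Qed.

Lemma nocarry_modl t n s : nocarry p n s -> nocarry p (n %% p ^ t) s.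
Proof.
move=> nc e; apply: leq_ltn_trans (nc e); rewrite leq_add2r.
case: (leqP e t) => [et|/ltnW te]; first by rewrite modn_dvdm ?dvdn_exp2l.
rewrite modn_small ?(leq_trans (ltn_pmod _ _)) ?leq_pexp2l ?expn_gt0 ?prime_gt0 //.
by rewrite -(modn_dvdm n (dvdn_exp2l p te)) leq_mod.
Qed.

Lemma logn_acoef_vertex t n s : nocarry p n s ->
  let x := p ^ t * (n %/ p ^ t) in
  x <= n /\ logn p (acoef n s x) + logn p x`! = logn p n`!.
Proof.
move=> nc x; have xn : x <= n by rewrite /x mulnC leq_divM.
split=> //; rewrite logn_acoef //.
have -> : n - x = n %% p ^ t by rewrite {1}(divn_eq n (p ^ t)) /x mulnC addKn.
by have /(logn_bin_eq0 _ _ p_pr)-> := @nocarry_modl t _ _ nc; rewrite addn0.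
Qed.

Lemma gpoly_edge_stop i n s : nocarry p n s ->
  edge_stop p (p ^ i) (repunit i) (gpoly n s) (p ^ i * (n %/ p ^ i)).
Proof.
move=> nc; have [xn xE] := logn_acoef_vertex i nc.
apply: edge_end_gpoly => // j jn.
have := fact_edge_stop i jn; have := logn_acoef s p_pr jn.
move: xE; move: (_ * _) => x; rewrite /gtn /ltn /=.
move: (p ^ i) (repunit i) => P R; clear; nia.
Qed.

Lemma gpoly_edge_start i n s : nocarry p n s ->
  edge_start p (p ^ i) (repunit i) (gpoly n s) (p ^ i.+1 * (n %/ p ^ i.+1)).
Proof.
move=> nc; have [xn xE] := logn_acoef_vertex i.+1 nc.
apply: edge_end_gpoly => // j jn.
have := fact_edge_start i jn; have := logn_acoef s p_pr jn.
move: xE; move: (_ * _) => x; rewrite /ltn /=.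
move: (p ^ i) (repunit i) => P R; clear; nia.
Qed.

Lemma coprime_repunit i : coprime (repunit i) (p ^ i).
Proof.
case: i => [|i]; first by rewrite expn0 coprimen1.
by rewrite coprimeXr // coprime_sym /= mulnC /coprime gcdnMDl gcdn1.
Qed.

Section Factor.
Variables (n s : nat) (f g : {poly int}).
Hypothesis fgE : gpoly n s = (f * g)%R.
Hypothesis nc : nocarry p n s.

Let fg0 : (f != 0)%R /\ (g != 0)%R.
Proof.
apply/andP; rewrite -negb_or -mulf_eq0 -fgE -size_poly_gt0 size_gpoly //.
Qed.

(** Descending induction on [i], that is, along the polygon from the left. In [f] edge [i] starts
    where edge [i.+1] stops, at a multiple of [p ^ i.+1], and its length is a multiple of [p ^ i].
    For [i >= n] it starts at 0. *)
Lemma factor_edge_stop_dvd i y :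
  edge_stop p (p ^ i) (repunit i) f y -> p ^ i %| y.
Proof.
have [f0 g0] := fg0; have p0 := prime_gt0 p_pr.
have q0 t : 0 < p ^ t by rewrite expn_gt0 p0.
have [m] := ubnP (n - i); elim: m i y => // m IH i y mi fy.
have [x fx] := edge_start_exists p_pr (p ^ i) (repunit i) f0.
have [xy dxy] := edge_dvdn p_pr (coprime_repunit i) fx fy.
suff dx : p ^ i %| x by rewrite -(subnKC xy) dvdn_add.
have := gpoly_edge_start i nc; rewrite fgE => fgs.
have [x' gx'] := edge_start_exists p_pr (p ^ i) (repunit i) g0.
have e := edge_start_uniq p_pr fgs (edge_startM p_pr (q0 i) fx gx').
case: (ltnP i n) => [ilt|ni]; last first.
  move: e; rewrite divn_small ?muln0; first by case: x fx {xy dxy} => // *; rewrite dvdn0.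
  by apply: leq_trans (ltn_expl _ (prime_gt1 p_pr)) _; rewrite leq_pexp2l // ltnW.
have := gpoly_edge_stop i.+1 nc; rewrite fgE => fgt.
have [z fz] := edge_stop_exists p_pr (p ^ i.+1) (repunit i.+1) f0.
have sl : repunit i * p ^ i.+1 < repunit i.+1 * p ^ i.
  by rewrite expnS /=; have := q0 i; nia.
rewrite -(edge_glue p_pr (q0 i.+1) (q0 i) sl f0 g0 fgt fgs fz fx).
apply: dvdn_trans (dvdn_exp2l p (leqnSn i)) (IH _ _ _ fz); lia.
Qed.

(** Up to the end [y] of edge [t] the degree is a multiple of [p ^ t]; beyond it, [f] and [g] share
    only [n %% p ^ t]. *)
Lemma factor_deg_mod t : (size f).-1 %% p ^ t <= n %% p ^ t.
Proof.
have [f0 g0] := fg0; have p0 := prime_gt0 p_pr.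
have q0 : 0 < p ^ t by rewrite expn_gt0 p0.
have [y fy] := edge_stop_exists p_pr (p ^ t) (repunit t) f0.
have [y' gy'] := edge_stop_exists p_pr (p ^ t) (repunit t) g0.
have := gpoly_edge_stop t nc; rewrite fgE => fgs.
have e := edge_stop_uniq p_pr fgs (edge_stopM p_pr q0 fy gy').
have /dvdnP[c yE] := factor_edge_stop_dvd fy.
have hf : y <= (size f).-1 := edge_end_le_deg p_pr fy.
have hg : y' <= (size g).-1 := edge_end_le_deg p_pr gy'.
have szf : 0 < size f by rewrite size_poly_gt0.
have szg : 0 < size g by rewrite size_poly_gt0.
have szM : size (f * g)%R = (size f + size g).-1 by exact: size_mul.
have szn := size_gpoly n s; rewrite fgE szM in szn.
have -> : (size f).-1 = c * p ^ t + ((size f).-1 - y) by rewrite -yE subnKC.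
rewrite modnMDl; apply: leq_trans (leq_mod _ _) _.
have nE := divn_eq n (p ^ t).
have : y + y' = n %/ p ^ t * p ^ t by rewrite -e mulnC.
by move: nE; clear -hf hg szf szg szn; lia.
Qed.

End Factor.
End Digits.

(** * Positivity in even degree *)

Section Laplace.
Local Open Scope ring_scope.

Variable R : realDomainType.
Implicit Types P Q : {poly R}.

(* [laplace Q] is the integral of [Q t * exp (- t)] over the positive reals. *)
Definition laplace Q := \sum_(j < size Q) Q`_j *+ j`!.

Lemma laplaceE m Q : (size Q <= m)%N -> laplace Q = \sum_(j < m) Q`_j *+ j`!.
Proof.
move=> szQ; rewrite /laplace (big_ord_widen _ (fun j => Q`_j *+ j`!) szQ).
rewrite big_mkcond /=; apply: eq_bigr => j _; case: ltnP => // h.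
by rewrite nth_default // mul0rn.
Qed.

Lemma laplaceD P Q : laplace (P + Q) = laplace P + laplace Q.
Proof.
have h := size_polyD P Q; rewrite (laplaceE h).
rewrite (laplaceE (leq_maxl (size P) (size Q))) (laplaceE (leq_maxr (size P) (size Q))).
by rewrite -big_split; apply: eq_bigr => j _; rewrite coefD mulrnDl.
Qed.

Lemma laplaceZ (c : R) Q : laplace (c *: Q) = c * laplace Q.
Proof.
rewrite (laplaceE (size_scale_leq c Q)) mulr_sumr.
by apply: eq_bigr => j _; rewrite coefZ mulrnAr.
Qed.

Lemma laplace_sum I (r : seq I) (F : I -> {poly R}) :
  laplace (\sum_(i <- r) F i) = \sum_(i <- r) laplace (F i).
Proof.
apply: (big_morph laplace laplaceD); by rewrite /laplace size_poly0 big_ord0.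
Qed.

Lemma laplaceXn k : laplace 'X^k = k`!%:R.
Proof.
rewrite /laplace size_polyXn big_ord_recr /= coefXn eqxx big1 ?add0r // => j _.
by rewrite coefXn ltn_eqF ?mul0rn.
Qed.

(** Integration by parts. *)
Lemma laplace_deriv Q : laplace Q = Q`_0 + laplace Q^`().
Proof.
rewrite (@laplaceE (size Q).+1 Q) // big_ord_recl fact0 mulr1n; congr (_ + _).
rewrite (@laplaceE (size Q)); last first.
  by case: (eqVneq Q 0) => [->|/lt_size_deriv/ltnW//]; rewrite linear0.
by apply: eq_bigr => j _; rewrite coef_deriv lift0 factS mulrnA.
Qed.

(** The preimage is the sum of all iterated derivatives of [Q]. *)
Lemma subr_deriv_surj Q : exists2 P : {poly R}, P - P^`() = Q & size P = size Q.
Proof.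
have [m] := ubnP (size Q); elim: m Q => // m IH Q szQ.
have [->|Q0] := eqVneq Q 0; first by exists 0; rewrite ?derivC ?subrr ?subr0 ?linear0 ?addr0.
have ltQ := lt_size_deriv Q0.
have [P PE szP] := IH Q^`() (leq_trans ltQ szQ).
exists (Q + P); last by rewrite size_polyDl // szP.
by rewrite derivD -{1}[P](subrK P^`()) PE; ring.
Qed.

(* Integrating [2 * P * P^`()] by parts turns the positivity for [P - P^`()] into
   that for polynomials of smaller degree or for a smaller exponent [k]. *)
Lemma laplace_sqr k P (Q := P - P^`()) :
  laplace ('X^k * Q ^+ 2) = ('X^k * P ^+ 2)`_0 +
    (k%:R * laplace ('X^(k.-1) * P ^+ 2) + laplace ('X^k * P^`() ^+ 2)).
Proof.
have -> : 'X^k * Q ^+ 2 =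
    'X^k * P ^+ 2 + ((-1) *: ('X^k * (P ^+ 2)^`()) + 'X^k * P^`() ^+ 2).
  by rewrite /Q expr2 derivM scaleN1r expr2; ring.
rewrite !laplaceD laplaceZ [laplace ('X^k * P ^+ 2)]laplace_deriv derivM derivXn.
rewrite mulrnAl -mulr_natl -polyC_natr mul_polyC laplaceD laplaceZ; ring.
Qed.

(** No term of [laplace_sqr] is negative. A positive one is the middle term if [k > 0], the last one
    if [k = 0] and [P] is not constant, and the square of [P] at 0 otherwise. *)
Lemma laplace_sqr_gt0 k Q : Q != 0 -> 0 < laplace ('X^k * Q ^+ 2).
Proof.
have [m] := ubnP (k + size Q); elim: m k Q => // m IH k Q szQ Q0.
have [P PE szP] := subr_deriv_surj Q.
have P0 : P != 0 by rewrite -size_poly_eq0 szP size_poly_eq0.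
have ge0 : 0 <= laplace ('X^k * P^`() ^+ 2).
  have [->|P'0] := eqVneq P^`() 0; first by rewrite expr0n mulr0 /laplace size_poly0 big_ord0.
  by apply/ltW/IH => //; have := lt_size_deriv P0; lia.
rewrite -PE laplace_sqr; case: k szQ ge0 => [|k] szQ ge0; last first.
  rewrite coefXnM add0r /= ltr_wpDr // mulr_gt0 ?ltr0n // IH //; lia.
rewrite expr0 !mul1r mul0r add0r in ge0 *; rewrite -horner_coef0 hornerE.
have [P'0|P'0] := eqVneq P^`() 0.
  have PC : P = (P`_0)%:P.
    apply/size1_polyC; rewrite leqNgt; apply/negP => szP1.
    have := congr1 (fun Q => Q`_(size P).-2) P'0.
    rewrite coef_deriv coef0 => /eqP; rewrite mulrn_eq0.
    have -> : (size P).-2.+1 = (size P).-1 by lia.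
    by rewrite -lead_coefE lead_coef_eq0 (negPf P0) orbF; lia.
  rewrite P'0 expr0n /laplace size_poly0 big_ord0 addr0 exprn_even_gt0 //=.
  by rewrite horner_coef0; apply: contra P0 => /eqP h; rewrite PC h.
rewrite ltr_wpDl ?sqr_ge0 // -[_ ^+ 2]mul1r -(expr0 'X) IH //.
by have := lt_size_deriv P0; lia.
Qed.

End Laplace.

Lemma horner_gpoly (n s : nat) (x : int) :
  ((gpoly n s).[x] * s`!%:R = laplace ('X^s * ('X + x%:P) ^+ n))%R.
Proof.
rewrite /gpoly horner_poly exprDn mulr_sumr laplace_sum mulr_suml.
apply: eq_bigr => i _; have ile : i <= n by rewrite -ltnS.
rewrite [in RHS]mulrnAr mulrA -exprD -rmorphXn mulrC [in RHS]mulrC mul_polyC -scaler_nat.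
rewrite laplaceZ laplaceZ.
rewrite -[Posz (acoef _ _ _)]natz [acoef _ _ _]/(_ * _)%N natrM.
have -> : (s + (n - i) = n + s - i)%N by lia.
rewrite laplaceXn -(@ffact_fact (n + s - i) (n - i)); last by lia.
by rewrite (_ : n + s - i - (n - i) = s)%N; [rewrite natrM; ring|lia].
Qed.

Lemma gpoly_no_root n s (x : int) : ~~ odd n -> ~~ root (gpoly n s) x.
Proof.
move=> n_even; have nE : n = n./2.*2 by rewrite halfK (negPf n_even) subn0.
apply/negP => /eqP/(congr1 (fun y => y * s`!%:R)%R).
rewrite horner_gpoly mul0r nE -muln2 exprM => /eqP.
by rewrite gt_eqF // laplace_sqr_gt0 // expf_neq0 // -size_poly_eq0 size_XaddC.
Qed.

(** * Reduction to integral factors of degree at most [n / 2] *)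

Lemma map_gpoly n s : map_poly intr (gpoly n s) = g1 n s.
Proof.
apply/polyP => j; rewrite coef_map coef_poly /g1 coefZ coef_sum.
under eq_bigr => i _ do rewrite !coefZ coefXn.
case: ltnP => [jn|nj]; last first.
  rewrite big1 ?mulr0 // => i _; rewrite gtn_eqF ?mulr0 //.
  exact: leq_trans (ltn_ord i) nj.
rewrite (bigD1 (Ordinal jn)) //= eqxx big1 ?addr0 => [|i ij]; last first.
  by rewrite [_ == _]eq_sym (negPf (_ : val i != j)) ?mulr0.
rewrite -pmulrn mulr1 mulrA -natrM.
have f0 : (j`!%:R != 0 :> rat)%R by rewrite pnatr_eq0 -lt0n fact_gt0.
apply: (mulIf f0); rewrite mulfVK // -natrM acoef_fact //.
have -> : n + s - j = n - j + s by lia.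
by rewrite -[in RHS]bin_sub ?leq_addr // addKn.
Qed.

(** By Gauss's lemma a rational divisor is proportional to an integral one; of this and its
    cofactor, one has degree at most [n / 2]. *)
Lemma irreducible_g1 n s : 0 < n ->
    (forall f g, gpoly n s = (f * g)%R ->
       0 < (size f).-1 -> ((size f).-1).*2 <= n -> False) ->
  irreducible_poly (g1 n s).
Proof.
move=> n0 nofactor.
have sz1 : size (g1 n s) = n.+1.
  by rewrite -map_gpoly size_map_inj_poly ?size_gpoly //; exact: intr_inj.
split=> [|q szq dvq]; first by rewrite sz1.
have dvq' := dvq; rewrite -map_gpoly in dvq'.
have [f [a a0 qE] [g fgE]] := dvdpP_rat_int dvq'.
have szf : size q = size f.
  by rewrite qE size_scale // size_map_inj_poly //; exact: intr_inj.
have fg0 : (f * g != 0)%R by rewrite -fgE -size_poly_gt0 size_gpoly.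
move: (fg0); rewrite mulf_eq0 negb_or => /andP[f0 g0].
have szM : size (f * g)%R = (size f + size g).-1 by exact: size_mul.
rewrite -fgE size_gpoly in szM.
have pf : 0 < size f by rewrite size_poly_gt0.
have pg : 0 < size g by rewrite size_poly_gt0.
rewrite -dvdp_size_eqp // sz1 szf.
case: (eqVneq (size f) n.+1) => // szfn; exfalso.
rewrite szf in szq.
have [small|big] := leqP (((size f).-1).*2) n.
  by apply: (nofactor f g) => //; lia.
by apply: (nofactor g f); rewrite ?[(g * _)%R]mulrC //; lia.
Qed.

(** * Degrees compatible with the divisibility criterion *)

(* A necessary condition for [k] to be the degree of a factor of [g1 n s]. *)
Definition compat n s k := forall p, prime p -> nocarry p n s ->
  forall t, k %% p ^ t <= n %% p ^ t.

(** Here [b] is a single digit, so a carry could only start at the lowest position. *)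
Lemma nocarry_of_mod p a b : prime p -> a %% p + b < p -> nocarry p a b.
Proof.
move=> p_pr abp [|t]; first by rewrite expn0 !modn1.
have p0 := prime_gt0 p_pr; have q0 : 0 < p ^ t by rewrite expn_gt0 p0.
have -> : a %% p ^ t.+1 = (a %/ p) %% p ^ t * p + a %% p.
  rewrite {1}(divn_eq a p) {1}(divn_eq (a %/ p) (p ^ t)) expnS.
  rewrite mulnDl -addnA -mulnA [_ ^ _ * _]mulnC modnMDl modn_small //.
  have := ltn_pmod (a %/ p) q0; have := ltn_pmod a p0; nia.
rewrite [b %% _]modn_small; last by rewrite expnS; nia.
by have := ltn_pmod (a %/ p) q0; rewrite expnS; nia.
Qed.

Lemma compat_prime n s k p : compat n s k -> prime p -> n %% p + s < p ->
  k %% p <= n %% p.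
Proof.
move=> cp p_pr h; have := cp p p_pr (nocarry_of_mod p_pr h) 1.
by rewrite expn1.
Qed.

(** Suppose [k + s <= p]. If [n %% p < k], adding [s] to [n] gives no carry and [compat] fails;
    otherwise adding [k] to [n - k] gives no carry and [p] does not divide the binomial. *)
Lemma compat_bin_prime n s k p : 0 < s -> k <= n -> compat n s k -> prime p ->
  p %| 'C(n, k) -> p < k + s.
Proof.
move=> s0 kn cp p_pr dvp; rewrite ltnNge; apply/negP => ksp.
have kp : k < p by lia.
case: (ltnP (n %% p) k) => nk.
  have := compat_prime cp p_pr; rewrite (modn_small kp) => /(_ _); lia.
have nc : nocarry p (n - k) k.
  apply: nocarry_of_mod => //.
  have -> : (n - k) %% p = n %% p - k.
    rewrite {1}(divn_eq n p) -addnBA // modnMDl modn_small //.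
    by have := ltn_pmod n (prime_gt0 p_pr); lia.
  by rewrite subnK // ltn_pmod // prime_gt0.
have := logn_bin_eq0 (n - k) k p_pr; rewrite subnK // => /iffRL/(_ nc).
have : 0 < logn p 'C(n, k) by rewrite logn_gt0 mem_primes p_pr bin_gt0 kn.
by case: (logn _ _).
Qed.

(** The valuation counts carries, of which there is none at a power of [p] exceeding [n]. *)
Lemma logn_bin_trunc_log n k p : prime p -> k <= n -> 0 < n ->
  logn p 'C(n, k) <= trunc_log p n.
Proof.
move=> p_pr kn n0; rewrite -{1}(subnK kn) (@logn_bin p _ _ n.+1) ?subnK //.
have tn : trunc_log p n < n.+1.
  by rewrite ltnS ltnW // (leq_trans (ltn_expl _ (prime_gt1 p_pr))) ?trunc_logP ?prime_gt1.
rewrite (big_cat_nat _ (n := (trunc_log p n).+1)) //=.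
rewrite [X in _ + X]big_nat [X in _ + X]big1 ?addn0; last first.
  move=> t /andP[lt _]; have npt : n < p ^ t.
    by apply: leq_trans (trunc_log_ltn n (prime_gt1 p_pr)) _; rewrite leq_pexp2l ?prime_gt0.
  by rewrite !modn_small; lia.
apply: (@leq_trans (\sum_(1 <= t < (trunc_log p n).+1) 1)).
  by apply: leq_sum => t _; apply: leq_b1.
by rewrite sum_nat_const_nat muln1 subn1.
Qed.

Lemma pfactor_bin_leq n k p : prime p -> k <= n -> 0 < n -> p ^ logn p 'C(n, k) <= n.
Proof.
move=> p_pr kn n0; apply: leq_trans (trunc_logP (prime_gt1 p_pr) n0).
by rewrite leq_pexp2l ?prime_gt0 ?logn_bin_trunc_log.
Qed.

Lemma prod_logn N B : 0 < N -> (forall p, prime p -> p %| N -> p < B) ->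
  N = \prod_(0 <= p < B | prime p) p ^ logn p N.
Proof.
move=> N0 H; rewrite -{1}[N]partnT // (widen_partn _ (leq_addr B N)).
rewrite (big_cat_nat _ (n := B)) //=; last by lia.
rewrite [X in _ * X]big_nat_cond [X in _ * X]big1 ?muln1 => [|p /andP[/andP[Bp _] _]].
  rewrite [RHS]big_mkcond /=; apply: eq_bigr => p _; case: ifP => // pp.
  by rewrite lognE pp.
rewrite lognE; case: ifP => // /and3P[pp _ /(H _ pp)]; lia.
Qed.

(* The primes are counted strictly below [B]; likewise for [primorial]. *)
Definition prime_pi B := \sum_(0 <= p < B | prime p) 1.

Lemma prod_leq_exp B (F : nat -> nat) n :
  (forall p, prime p -> p < B -> F p <= n) ->
  \prod_(0 <= p < B | prime p) F p <= n ^ prime_pi B.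
Proof.
move=> H; rewrite /prime_pi expn_sum big_nat_cond [leqRHS]big_nat_cond.
by apply: leq_prod => p /andP[/andP[_ pB] pp]; rewrite expn1 H.
Qed.

Lemma compat_bin_leq n s k : 0 < s -> 0 < n -> k <= n -> compat n s k ->
  'C(n, k) <= n ^ prime_pi (k + s).
Proof.
move=> s0 n0 kn cp; rewrite [leqLHS](@prod_logn _ (k + s)) ?bin_gt0 //; last first.
  by move=> p; apply: compat_bin_prime.
by apply: prod_leq_exp => p pp _; apply: pfactor_bin_leq.
Qed.

(** Factor by factor, [n * (k - i) <= k * (n - i)]. *)
Lemma bin_exp_geq n k : k <= n -> n ^ k <= k ^ k * 'C(n, k).
Proof.
move=> kn; rewrite -(leq_pmul2r (fact_gt0 k)) -mulnA bin_ffact -[in leqLHS]ffactnn.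
have e m : m ^ k = \prod_(i < k) m by rewrite prod_nat_const card_ord.
rewrite !ffact_prod !e -!big_split /=.
by apply: leq_prod => i _; have := ltn_ord i; nia.
Qed.

Lemma prime_piE B : prime_pi B = size (filter prime (iota 0 B)).
Proof. by rewrite /prime_pi -big_filter sum1_size /index_iota subn0. Qed.

Lemma prime_pi_recr B : prime_pi B.+1 = prime_pi B + prime B.
Proof. by rewrite /prime_pi big_mkcond big_nat_recr //= -big_mkcond /=; case: prime. Qed.

Lemma leq_prime_pi B B' : B <= B' -> prime_pi B <= prime_pi B'.
Proof.
move=> h; rewrite -(subnKC h); elim: (B' - B) => [|d]; first by rewrite addn0.
by rewrite addnS prime_pi_recr; lia.
Qed.

Lemma prime_pi_add B d : 5 < B ->
  prime_pi (B + d) <= prime_pi B + \sum_(0 <= i < d) coprime 30 (B + i).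
Proof.
move=> B5; elim: d => [|d IH]; first by rewrite addn0 big_geq ?addn0.
rewrite addnS prime_pi_recr big_nat_recr //= addnA leq_add //.
case pB: (prime (B + d)) => //=; rewrite lt0b coprime_sym prime_coprime //.
apply/negP => dv; have : (B + d) \in primes 30 by rewrite mem_primes pB.
by rewrite (_ : primes 30 = [:: 2; 3; 5]) // !inE; lia.
Qed.

(** Of 30 consecutive integers, 8 are coprime to 30, and primes above 5 are among these. The
    constant 80 absorbs the start, checked for [B < 36]; then induction goes by steps of 30. *)
Lemma prime_pi_leq B : 30 * prime_pi B <= 8 * B + 80.
Proof.
have small : all (fun B => 30 * size (filter prime (iota 0 B)) <= 8 * B + 80) (iota 0 36).
  by vm_compute.
have [m] := ubnP B; elim: m B => // m IH B; case: (ltnP B 36) => [B36 _|B36 Bm].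
  have := allP small B; rewrite mem_iota B36 => /(_ isT).
  by rewrite prime_piE.
have /IH IH' : B - 30 < m by lia.
have := @prime_pi_add (B - 30) 30; rewrite subnK; last by lia.
have -> : \sum_(0 <= i < 30) coprime 30 (B - 30 + i) = 8; last by lia.
rewrite (eq_bigr (fun i => nat_of_bool (coprime 30 ((B - 30) %% 30 + i)))); last first.
  by move=> i _; rewrite -coprime_modr -modnDml coprime_modr.
have : (B - 30) %% 30 < 30 by rewrite ltn_mod.
by move: (_ %% 30); do 30! (case; first by rewrite unlock).
Qed.

(** * Large degrees *)

Lemma prod_primes_dvd (r : seq nat) N : uniq r -> all prime r ->
  all (fun p => p %| N) r -> \prod_(p <- r) p %| N.
Proof.
elim: r => [|p r IH] /=; first by rewrite big_nil dvd1n.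
case/andP=> pr ur /andP[pp ppr] /andP[pN rN]; rewrite big_cons.
rewrite Gauss_dvd ?pN ?IH //; elim: r pr ppr {IH ur rN} => [|q r IH] /=.
  by rewrite big_nil coprimen1.
rewrite inE negb_or => /andP[pq pr] /andP[qq ppr].
by rewrite big_cons coprimeMr IH // andbT prime_coprime // dvdn_prime2.
Qed.

Definition primorial B := \prod_(0 <= p < B | prime p) p.

Lemma primorial_recr B : primorial B.+1 = primorial B * (if prime B then B else 1).
Proof. by rewrite /primorial big_mkcond big_nat_recr //= -big_mkcond. Qed.

Lemma bin_mid_leq m : 'C(m.*2.+1, m) <= 4 ^ m.
Proof.
have : \sum_(i < m.*2.+2) 'C(m.*2.+1, i) = 2 ^ m.*2.+1.
  rewrite -[2]/(1 + 1) expnDn; apply: eq_bigr => i _.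
  by rewrite !exp1n !muln1.
have lt1 : m < m.*2.+2 by lia.
have lt2 : m.+1 < m.*2.+2 by lia.
rewrite (bigD1 (Ordinal lt1)) //= (bigD1 (Ordinal lt2)) /=; last by rewrite -val_eqE /= gtn_eqF.
have -> : 'C(m.*2.+1, m.+1) = 'C(m.*2.+1, m).
  by rewrite -[RHS]bin_sub; [congr 'C(_, _); lia|lia].
have -> : 2 ^ m.*2.+1 = 2 * 4 ^ m by rewrite expnS -mul2n expnM.
by move: (\sum_(_ < _ | _) _) ('C(_, _)) (4 ^ _) => a b c; lia.
Qed.

(** Erdos's argument: for an odd bound [h.*2.+1], the primes from [h.+2] on all divide
    ['C(h.*2.+1, h)]; an even bound above 2 adds no prime. *)
Lemma primorial_leq B : primorial B.+1 <= 4 ^ B.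
Proof.
have [m] := ubnP B; elim: m B => // m IH [|[|B]] Bm.
- by rewrite /primorial unlock.
- by rewrite /primorial unlock.
have [odB|evB] := boolP (odd B); last first.
  rewrite primorial_recr; have -> : prime B.+2 = (B == 0).
    apply/idP/eqP => [pB|->//]; case: (even_prime pB) => [[//]|]; lia.
  case: eqP => [->|_]; first by rewrite /primorial unlock.
  by rewrite muln1; apply: leq_trans (IH B.+1 _) _; rewrite ?leq_pexp2l //; lia.
have [h BE] : exists h, B.+3 = h.*2.+2 by exists B./2.+1; lia.
rewrite BE (_ : B.+2 = h.*2.+1); last by lia.
have hd : primorial h.*2.+2 = primorial h.+2 * \prod_(h.+2 <= p < h.*2.+2 | prime p) p.
  by rewrite /primorial [LHS](big_cat_nat _ (n := h.+2)) //=; lia.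
have hu : \prod_(h.+2 <= p < h.*2.+2 | prime p) p <= 'C(h.*2.+1, h).
  rewrite -big_filter dvdn_leq ?bin_gt0 //; first by lia.
  apply: prod_primes_dvd; rewrite ?filter_uniq ?iota_uniq ?filter_all //.
  apply/allP => p; rewrite mem_filter mem_index_iota => /and3P[pp lp pl].
  have : p %| h.*2.+1`! by rewrite dvdn_fact // prime_gt0 //; lia.
  rewrite -(@bin_fact h.*2.+1 h); last by lia.
  have -> : h.*2.+1 - h = h.+1 by lia.
  rewrite Euclid_dvdM // => /orP[//|]; rewrite Euclid_dvdM //.
  have nd i : i < p -> (p %| i`!) = false; last by rewrite !nd //; lia.
  elim: i => [|i IHi] ip; first by rewrite dvdn1 gtn_eqF // prime_gt1.
  by rewrite factS Euclid_dvdM // IHi ?(ltnW ip) // orbF gtnNdvd.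
have IH' : primorial h.+2 <= 4 ^ h.+1 by apply: IH; lia.
have := leq_mul IH' (leq_trans hu (bin_mid_leq h)); rewrite hd -expnD.
by have -> : h.+1 + h = h.*2.+1 by lia.
Qed.

Lemma pfactor_bin_leq_prime n k p : prime p -> k <= n -> 0 < n -> n < p ^ 2 ->
  p ^ logn p 'C(n, k) <= p.
Proof.
move=> p_pr kn n0 np; rewrite -[leqRHS]expn1 leq_pexp2l ?prime_gt0 //.
apply: leq_trans (logn_bin_trunc_log p_pr kn n0) _.
rewrite leqNgt; apply/negP => h.
have := leq_trans (leq_pexp2l (prime_gt0 p_pr) h) (trunc_logP (prime_gt1 p_pr) n0).
by rewrite leqNgt np.
Qed.

(* Primes [p >= r] occur in ['C(n, k)] with exponent at most one. *)
Lemma bin_leq_primorial n k r B : k <= n -> 0 < n -> n < r ^ 2 ->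
    (forall p, prime p -> p %| 'C(n, k) -> p < B) ->
  'C(n, k) <= n ^ prime_pi r * \prod_(0 <= p < B | prime p && (p %| 'C(n, k))) p.
Proof.
move=> kn n0 nr H; have N0 : 0 < 'C(n, k) by rewrite bin_gt0.
rewrite {1}(@prod_logn 'C(n, k) (maxn r B)) //; last first.
  by move=> p pp dp; rewrite leq_max (H p) // orbT.
apply: (@leq_trans (\prod_(0 <= p < maxn r B | prime p)
    ((if p < r then n else 1) * (if (p < B) && (p %| 'C(n, k)) then p else 1)))).
  rewrite big_nat_cond [leqRHS]big_nat_cond.
  apply: leq_prod => p /andP[_ pp]; case dp: (p %| 'C(n, k)); last first.
    rewrite lognE pp N0 dp expn0 andbF muln1; by case: ifP.
  rewrite (H p) //=; case: ltnP => pr.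
    by rewrite (leq_trans (pfactor_bin_leq pp kn n0)) // leq_pmulr // prime_gt0.
  by rewrite mul1n pfactor_bin_leq_prime // (leq_trans nr) // leq_exp2r.
rewrite big_split /= leq_mul //.
  rewrite -big_mkcondr /=; apply: leq_trans (@prod_leq_exp r (fun=> n) n _) => //.
  by rewrite [leqRHS](big_nat_widen _ _ _ _ _ (leq_maxl r B)).
rewrite -big_mkcondr /= [leqRHS](big_nat_widen _ _ _ _ _ (leq_maxr r B)).
by under eq_bigl => p do rewrite [(p < B) && _]andbC andbA.
Qed.

(** Serves as a bound for the binary logarithm of [t.+1]. Below, [t] is the integer fourth root of
    [k], and all estimates become polynomial in [t]. The start is [12 ^ 8 <= 2 ^ 29], the step
    [(13 / 12) ^ 8 <= 2]. *)
Lemma exp8_leq t : 11 <= t -> t.+1 ^ 8 <= 2 ^ (t + 18).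
Proof.
move=> t11; rewrite -(subnK t11); elim: (t - 11) => [|d IH]; first by lia.
have h : (12 * (d + 11).+2) ^ 8 <= (13 * (d + 11).+1) ^ 8 by rewrite leq_exp2r //; lia.
rewrite !expnMn in h; rewrite !addSn (expnS 2).
have e : 13 ^ 8 <= 2 * 12 ^ 8 by lia.
have c0 : 0 < 12 ^ 8 by lia.
move: (12 ^ 8) (13 ^ 8) h e c0 => a b h e c0.
rewrite -(leq_pmul2l c0); apply: leq_trans h _; rewrite mulnCA mulnA.
exact: leq_mul.
Qed.

(** The ratio of consecutive binomials tends to [27 / 4]; the factor [3 * k + 1] makes up for the
    shortfall. *)
Lemma bin_3k k : 27 ^ k <= 4 ^ k * (3 * k + 1) * 'C(3 * k, k).
Proof.
elim: k => [|k IH]; first by rewrite bin0.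
have rec : 'C(3 * k.+1, k.+1) * (2 * (2 * k + 1) * (k + 1)) =
    3 * (3 * k + 1) * (3 * k + 2) * 'C(3 * k, k).
  have f1 : 'C(3 * k, k) * (k`! * (2 * k)`!) = (3 * k)`!.
    by rewrite -(@bin_fact (3 * k) k); [do 2 congr (_ * _); congr _`!; lia | lia].
  have f2 : 'C(3 * k.+1, k.+1) * (k.+1`! * (2 * k).+2`!) = (3 * k).+3`!.
    have -> : (3 * k).+3 = 3 * k.+1 by lia.
    by rewrite -(@bin_fact (3 * k.+1) k.+1); [do 2 congr (_ * _); congr _`!; lia | lia].
  rewrite !factS -f1 in f2.
  have c0 : 0 < k.+1 * (k`! * (2 * k)`!) by rewrite !muln_gt0 !fact_gt0.
  apply/eqP; rewrite -(eqn_pmul2r c0); apply/eqP.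
  by move: (k`!) ((2 * k)`!) f2 => a b f2; clear -f2; nia.
have c0 : 0 < 2 * (2 * k + 1) * (k + 1) by nia.
rewrite -(leq_pmul2r c0) -[leqRHS]mulnA rec !expnS.
have step : (3 * k + 1) * (27 * (2 * (2 * k + 1) * (k + 1))) <=
    4 * (3 * k.+1 + 1) * (3 * (3 * k + 1) * (3 * k + 2)) by nia.
move: step IH; move: (27 ^ k) (4 ^ k) ('C(_, _)) => A B C step IH.
have := leq_mul IH (leqnn (27 * (2 * (2 * k + 1) * (k + 1)))).
have := leq_mul (leqnn (B * C)) step.
by clear; nia.
Qed.

Lemma bin_2k k : 4 ^ k <= (2 * k + 1) * 'C(2 * k, k).
Proof.
elim: k => [|k IH]; first by rewrite bin0.
have rec : 'C(2 * k.+1, k.+1) * (k + 1) = 2 * (2 * k + 1) * 'C(2 * k, k).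
  have f1 : 'C(2 * k, k) * (k`! * k`!) = (2 * k)`!.
    by rewrite -(@bin_fact (2 * k) k); [do 2 congr (_ * _); congr _`!; lia | lia].
  have f2 : 'C(2 * k.+1, k.+1) * (k.+1`! * k.+1`!) = (2 * k).+2`!.
    have -> : (2 * k).+2 = 2 * k.+1 by lia.
    by rewrite -(@bin_fact (2 * k.+1) k.+1); [do 2 congr (_ * _); congr _`!; lia | lia].
  rewrite !factS -f1 in f2.
  have c0 : 0 < k.+1 * (k`! * k`!) by rewrite !muln_gt0 !fact_gt0.
  apply/eqP; rewrite -(eqn_pmul2r c0); apply/eqP.
  by move: (k`!) f2 => a f2; clear -f2; nia.
have c0 : 0 < k + 1 by lia.
rewrite -(leq_pmul2r c0) -[leqRHS]mulnA rec expnS.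
move: IH; move: (4 ^ k) ('C(_, _)) => A C IH.
have := leq_mul IH (leqnn (4 * (k + 1))).
by clear; nia.
Qed.

(** Raising the upper index by one multiplies the binomial by at least [3 / 2] as long as it stays
    at most [3 * k]. *)
Lemma bin_2k_add k j : j <= k ->
  3 ^ j * 4 ^ k <= 2 ^ j * ((2 * k + 1) * 'C(2 * k + j, k)).
Proof.
elim: j => [|j IH] jk; first by rewrite !mul1n addn0 bin_2k.
have rec : 3 * 'C(2 * k + j, k) <= 2 * 'C(2 * k + j.+1, k).
  have e : (2 * k + j.+1 - k) * 'C(2 * k + j.+1, k) = (2 * k + j.+1) * 'C(2 * k + j, k).
    have := mul_bin_down (2 * k + j.+1) k.
    by rewrite addnS.
  have c0 : 0 < 2 * k + j.+1 - k by lia.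
  rewrite -(leq_pmul2l c0).
  have -> : (2 * k + j.+1 - k) * (2 * 'C(2 * k + j.+1, k)) =
    2 * ((2 * k + j.+1) * 'C(2 * k + j, k)) by rewrite -e mulnCA.
  rewrite !mulnA leq_pmul2r ?bin_gt0; lia.
rewrite !expnS; have := leq_mul (leqnn 3) (IH (ltnW jk)).
have := leq_mul (leqnn (2 ^ j * (2 * k + 1))) rec.
move: ('C(_, _)) ('C(_, _)) (3 ^ j) (2 ^ j) (4 ^ k) => C C' a b c; clear; nia.
Qed.

Lemma leq_expl m n e : m <= n -> m ^ e <= n ^ e.
Proof. by case: e => // e mn; rewrite leq_exp2r. Qed.

Lemma pow4E m : 4 ^ m = 2 ^ (2 * m).
Proof. by rewrite expnM. Qed.

Section LargeDegree.
Variables n s k : nat.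
Hypotheses (s_range : 0 < s <= 30) (kn : 2 * k <= n).
Hypothesis cp : compat n s k.

Let k_le_n : k <= n. Proof. lia. Qed.
Let prime_bound p : prime p -> p %| 'C(n, k) -> p < k + 30.
Proof.
have s0 : 0 < s by lia.
by move=> pp dp; have := compat_bin_prime s0 k_le_n cp pp dp; lia.
Qed.

(** With [k ^ k] at most [n ^ (2 * k / 3)], the two bounds on the binomial give
    [k <= 3 * prime_pi (k + s)], which by [prime_pi_leq] and [s <= 30] means [k <= 160]. *)
Lemma not_compat_cube : 160 < k -> k ^ 3 <= n ^ 2 -> False.
Proof.
move=> k160 kn3; have n1 : 1 < n by lia.
have h : n ^ k <= k ^ k * n ^ prime_pi (k + s).
  apply: leq_trans (bin_exp_geq k_le_n) _; rewrite leq_mul2l; apply/orP; right.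
  by apply: compat_bin_leq => //; lia.
have h3 : n ^ (k * 3) <= n ^ (2 * k + prime_pi (k + s) * 3).
  apply: leq_trans (_ : (k ^ k * n ^ prime_pi (k + s)) ^ 3 <= _).
    by rewrite expnM leq_exp2r.
  rewrite expnMn expnD; apply: leq_mul; last by rewrite -expnM.
  by rewrite -expnM mulnC expnM [leqRHS]expnM leq_exp2r //; lia.
rewrite leq_exp2l // in h3.
have := prime_pi_leq (k + s); lia.
Qed.

Variable t : nat.
Hypotheses (t11 : 11 <= t) (tk : t ^ 4 <= k) (kt : k < t.+1 ^ 4).

Let u := t.+1.

(** As [n < u ^ 6], primes from [u ^ 3] on occur at most once, so up to a smaller factor the
    binomial is at most [4 ^ k], against a lower bound close to [(27 / 4) ^ k]. *)
Lemma not_compat_3k : 3 * k <= n -> n ^ 2 < k ^ 3 -> False.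
Proof.
move=> k3n nk.
have nu6 : n < u ^ 6.
  rewrite -(@ltn_exp2r _ _ 2) // (leq_trans nk) // -expnM.
  by rewrite (_ : 6 * 2 = 4 * 3) // expnM leq_exp2r // ltnW.
have nr : n < (u ^ 3) ^ 2 by rewrite -expnM.
have t0 : 0 < t ^ 4 by rewrite expn_gt0 (leq_trans _ t11).
have n0 : 0 < n by lia.
have hN : 'C(n, k) <= n ^ prime_pi (u ^ 3) * 4 ^ (k + 29).
  apply: leq_trans (bin_leq_primorial k_le_n n0 nr prime_bound) _.
  rewrite leq_mul2l; apply/orP; right; apply: leq_trans (_ : primorial (k + 30) <= _).
    rewrite /primorial big_mkcond [leqRHS]big_mkcond /=; apply: leq_prod => p _.
    by case pp: (prime p) => //=; case: ifP => // _; rewrite prime_gt0.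
  by rewrite addnS primorial_leq.
have h27 : 27 ^ k <= 4 ^ k * (3 * k + 1) * (n ^ prime_pi (u ^ 3) * 4 ^ (k + 29)).
  apply: leq_trans (bin_3k k) _; rewrite leq_mul2l (leq_trans _ hN) ?orbT //.
  by rewrite leq_bin2l.
have u8 : u ^ 8 <= 2 ^ (t + 18) by exact: exp8_leq.
have u0 : 0 < u by [].
have k3u : 3 * k + 1 <= u ^ 5.
  apply: leq_trans (_ : 3 * u ^ 4 <= _); first by move: kt; rewrite -/u; clear; lia.
  by rewrite expnS leq_mul2r; move: t11; rewrite /u; clear; lia.
set P := prime_pi _ in h27.
(* All factors of [h27], raised to the power 40, are compared with powers of 2. *)
have {}h27 : 2 ^ (190 * k) <=
    2 ^ (80 * k + (t + 18) * 25 + ((t + 18) * (30 * P) + 80 * (k + 29))).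
  apply: leq_trans (_ : (27 ^ k) ^ 40 <= _).
    (* This uses [2 ^ 19 <= 27 ^ 4]. *)
    have -> : 190 * k = 19 * (10 * k) by lia.
    have -> : (27 ^ k) ^ 40 = 27 ^ (4 * (10 * k)) by rewrite -expnM; congr (_ ^ _); lia.
    rewrite expnM [leqRHS]expnM; apply: leq_expl; lia.
  apply: leq_trans (_ : (4 ^ k * (3 * k + 1) * (n ^ P * 4 ^ (k + 29))) ^ 40 <= _).
    by rewrite leq_exp2r.
  rewrite [leqRHS]expnD expnMn.
  apply: leq_mul; rewrite [leqRHS]expnD expnMn; apply: leq_mul.
  - by rewrite -expnM pow4E leq_pexp2l //; lia.
  - apply: leq_trans (_ : (u ^ 5) ^ 40 <= _); first by rewrite leq_exp2r.
    have -> : (u ^ 5) ^ 40 = (u ^ 8) ^ 25 by rewrite -!expnM.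
    by rewrite [leqRHS]expnM leq_exp2r.
  - rewrite -expnM; apply: leq_trans (_ : (u ^ 6) ^ (P * 40) <= _).
      by rewrite leq_expl // ltnW.
    have -> : (u ^ 6) ^ (P * 40) = (u ^ 8) ^ (30 * P).
      by rewrite -!expnM; congr (_ ^ _); lia.
    by rewrite [leqRHS]expnM leq_expl.
  - by rewrite -expnM pow4E leq_pexp2l //; lia.
rewrite leq_exp2l // in h27.
have := prime_pi_leq (u ^ 3); rewrite -/P => hP.
have hPt : (t + 18) * (30 * P) <= (t + 18) * (8 * u ^ 3 + 80) by rewrite leq_mul2l hP orbT.
move: tk h27 hPt; rewrite /u !expnS expn0 !muln1; clear -t11.
move: ((t + 18) * (30 * P)) => Y.
rewrite -(subnK t11); move: (t - 11) => d; nia.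
Qed.

(** Near [n = 2 * k] the binomial is only about [4 ^ k], so the primorial of [k] is too large a
    bound. Dropping the primes between [n / 3] and [k] leaves [4 ^ (n / 3)], and those between [k]
    and [k + 30] give at most [n ^ 29]. *)
Lemma not_compat_lt3k : n < 3 * k -> False.
Proof.
move=> n3k; have u12 : 12 <= u by [].
have nu : n < 3 * u ^ 4 by apply: ltn_trans n3k _; rewrite ltn_mul2l.
have nu5 : n < u ^ 5 by rewrite expnS (leq_trans nu) // leq_mul2r; lia.
have nu5' := ltnW nu5.
have t4 : 11 * (11 * (11 * 11)) <= t ^ 4.
  by rewrite (_ : 11 * _ = 11 ^ 4) ?leq_exp2r //; lia.
(* Large enough for [n < r ^ 2], yet at most [n / 3], so that the discarded primes also satisfy
   [n < p ^ 2]. *)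
set r := 2 * u ^ 2.
have nr : n < r ^ 2.
  by apply: leq_trans nu _; rewrite /r expnMn -expnM leq_mul2r; lia.
have rn : r <= n %/ 3.
  rewrite leq_divRL //; have : t ^ 4 * 2 <= n by lia.
  rewrite /r /u !expnS expn0; move: t11; clear.
  move=> t11; rewrite -(subnK t11); move: (t - 11) => d; nia.
have n0 : 0 < n by lia.
have hN : 'C(n, k) <= n ^ prime_pi r * (4 ^ (n %/ 3) * n ^ 29).
  apply: leq_trans (bin_leq_primorial k_le_n n0 nr prime_bound) _.
  rewrite leq_mul2l; apply/orP; right.
  apply: leq_trans (_ : primorial (n %/ 3).+1 * \prod_(k.+1 <= p < k + 30) n <= _); last first.
    rewrite prod_nat_const_nat (_ : k + 30 - k.+1 = 29); last by lia.
    by rewrite leq_mul2r primorial_leq orbT.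
  have nk : (n %/ 3).+1 <= k.+1 by lia.
  rewrite (big_cat_nat _ (n := (n %/ 3).+1)) //=; last by lia.
  rewrite leq_mul //.
    rewrite /primorial big_mkcond [leqRHS]big_mkcond /=; apply: leq_prod => p _.
    by case pp: (prime p) => //=; case: ifP => // _; rewrite prime_gt0.
  rewrite (big_cat_nat _ (n := k.+1)) //=; last by lia.
  rewrite big_nat_cond big1 ?mul1n => [|p /andP[/andP[np pk] /andP[pp dp]]].
    rewrite big_mkcond /= big_nat [leqRHS]big_nat; apply: leq_prod => p /andP[_ pk].
    by case: ifP => // _; lia.
  (* For [n / 3 < p <= k], no carry occurs in [(n - k) + k] in base [p]. *)
  suff l0 : logn p 'C(n, k) = 0.
    have : 0 < logn p 'C(n, k) by rewrite logn_gt0 mem_primes pp bin_gt0 k_le_n.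
    by rewrite l0.
  rewrite -(subnK k_le_n); apply/logn_bin_eq0 => // -[|e].
    by rewrite expn0 !modn1.
  have pn : n < p * p by have := leq_mul np np; move: nr; rewrite -mulnn; move: rn; clear; nia.
  case: e => [|e].
    rewrite expn1; have kE : k %% p = k - p.
      by rewrite -[in LHS](@subnK p k) ?modnDr ?modn_small //; lia.
    have -> : (n - k) %% p = n - k - p.
      by rewrite -[in LHS](@subnK p (n - k)) ?modnDr ?modn_small //; lia.
    by rewrite kE; lia.
  have pe : n < p ^ e.+2.
    apply: leq_trans pn _; rewrite -[p * p]/(p ^ 2) leq_pexp2l //; lia.
  by rewrite !modn_small ?subnK //; lia.
set P := prime_pi r in hN.
pose j := n - 2 * k; have jk : j <= k by rewrite /j; lia.
have nE : 2 * k + j = n by rewrite /j subnKC.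
have := bin_2k_add jk; rewrite nE => h.
have N3 : 'C(n, k) ^ 3 <= n ^ (3 * P) * (4 ^ n * n ^ 87).
  apply: leq_trans (_ : (n ^ P * (4 ^ (n %/ 3) * n ^ 29)) ^ 3 <= _).
    by rewrite leq_exp2r.
  rewrite expnMn (expnMn (4 ^ _)) -!expnM [P * 3]mulnC.
  apply: leq_mul => //; apply: leq_mul => //.
  by rewrite leq_pexp2l // leq_divM.
have h3 : 27 ^ j * 64 ^ k <= 8 ^ j * ((2 * k + 1) ^ 3 * (n ^ (3 * P) * (4 ^ n * n ^ 87))).
  apply: leq_trans (_ : (2 ^ j * ((2 * k + 1) * 'C(n, k))) ^ 3 <= _).
    apply: leq_trans (_ : (3 ^ j * 4 ^ k) ^ 3 <= _); last by rewrite leq_exp2r.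
    by rewrite expnMn -!expnM ![_ * 3]mulnC !expnM.
  rewrite expnMn (expnMn (2 * k + 1)) -expnM [j * 3]mulnC (expnM 2 3).
  by apply: leq_mul => //; apply: leq_mul.
have h4 : 2 ^ k <= u ^ (15 * P + 450).
  have k2u : 2 * k + 1 <= u ^ 5 by rewrite addn1; exact: leq_ltn_trans kn nu5.
  (* The exponential parts leave [2 ^ k] because [32 * 16 * 2 <= 27 * 64]; replacing 27 by 32 in the
     power [k - j] removes [j]. *)
  have c0 : 0 < 32 ^ k * 16 ^ k by rewrite muln_gt0 !expn_gt0.
  rewrite -(leq_pmul2l c0).
  apply: leq_trans (_ : 27 ^ (k - j) * (27 ^ j * 64 ^ k) <= _).
    by rewrite mulnA -expnD subnK // -!expnMn leq_expl.
  apply: leq_trans (_ : 32 ^ (k - j) * (8 ^ j * ((u ^ 5) ^ 3 *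
      ((u ^ 5) ^ (3 * P) * (4 ^ n * (u ^ 5) ^ 87)))) <= _).
    apply: leq_mul; first by rewrite leq_expl.
    apply: leq_trans h3 _; rewrite leq_mul2l; apply/orP; right.
    apply: leq_mul; first by rewrite leq_exp2r.
    apply: leq_mul; first by rewrite leq_expl.
    by rewrite leq_mul2l leq_expl ?orbT.
  have -> : 4 ^ n = 16 ^ k * 4 ^ j by rewrite -nE expnD expnM.
  have -> : 32 ^ k = 32 ^ (k - j) * (8 ^ j * 4 ^ j) by rewrite -expnMn -expnD subnK.
  have -> : u ^ (15 * P + 450) = (u ^ 5) ^ 3 * ((u ^ 5) ^ (3 * P) * (u ^ 5) ^ 87).
    by rewrite -!expnM -!expnD; congr (_ ^ _); lia.
  by apply/eq_leq; ring.
have h5 : 2 ^ (k * 8) <= 2 ^ ((t + 18) * (15 * P + 450)).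
  rewrite expnM; apply: leq_trans (_ : (u ^ (15 * P + 450)) ^ 8 <= _).
    by rewrite leq_exp2r.
  by rewrite -expnM mulnC expnM [leqRHS]expnM leq_expl // exp8_leq.
rewrite leq_exp2l // in h5.
have := prime_pi_leq r; rewrite -/P => hP.
have hPt : (t + 18) * (30 * P + 900) <= (t + 18) * (8 * r + 980) by rewrite leq_mul2l; lia.
have {}h5 : 16 * k <= (t + 18) * (8 * r + 980).
  by apply: leq_trans hPt; move: h5; clear; nia.
move: tk h5; rewrite /r /u !expnS expn0 !muln1; clear -t11.
rewrite -(subnK t11); move: (t - 11) => d; nia.
Qed.

End LargeDegree.

Lemma not_compat_large n s k : 0 < s <= 30 -> 2 * k <= n -> 11 ^ 4 <= k ->
  ~ compat n s k.
Proof.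
move=> sr kn k11 cp.
have [t tk kt] : exists2 t, t ^ 4 <= k & k < t.+1 ^ 4.
  have ex : exists t, t ^ 4 <= k by exists 0.
  have ub t : t ^ 4 <= k -> t <= k.
    by apply: leq_trans; case: t => // t; rewrite -[leqLHS]expn1 leq_pexp2l.
  have [t tk tmax] := ex_maxnP ex ub; exists t => //.
  by rewrite ltnNge; apply/negP => /tmax; rewrite ltnn.
have t11 : 11 <= t by rewrite -ltnS -(@ltn_exp2r 11 t.+1 4) // (leq_ltn_trans k11).
case: (ltnP n (3 * k)) => [|n3k]; first exact: (not_compat_lt3k sr kn cp t11 tk kt).
case: (ltnP (n ^ 2) (k ^ 3)) => h; first exact: (not_compat_3k sr kn cp t11 tk kt n3k h).
apply: (not_compat_cube sr kn cp) h.
by apply: leq_trans k11; rewrite !expnS; lia.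
Qed.

(** * Medium degrees *)

(** The binomial bounds give [n ^ (k - prime_pi (k + 30)) <= k ^ k]; the numerical condition
    contradicts this in binary logarithms, at least [a] for [n] and at most [b / c] for [k]. *)
Lemma not_compat_exp n s k a b c : s <= 30 -> 0 < s -> 2 * k <= n -> 0 < k ->
    k ^ c <= 2 ^ b -> 2 ^ a <= n -> b * k < a * c * (k - prime_pi (k + 30)) ->
  ~ compat n s k.
Proof.
move=> s30 s0 kn k0 kcb an bkac cp.
have n0 : 0 < n by lia.
have le_nk : n ^ k <= k ^ k * n ^ prime_pi (k + 30).
  apply: leq_trans (bin_exp_geq (_ : k <= n)) _; first by lia.
  rewrite leq_mul2l (leq_trans (@compat_bin_leq n s k _ _ _ _)) ?orbT //; first by lia.
  by rewrite leq_pexp2l // leq_prime_pi // leq_add2l.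
set m := k - _ in bkac; have km : k = prime_pi (k + 30) + m by rewrite /m; nia.
have {}le_nk : n ^ m <= k ^ k.
  move: le_nk; rewrite {1}km addnC expnD leq_pmul2r ?expn_gt0 ?n0 //.
have : 2 ^ (a * c * m) <= 2 ^ (b * k).
  apply: leq_trans (_ : (n ^ m) ^ c <= _).
    by rewrite -expnM [m * c]mulnC -mulnA expnM leq_expl.
  apply: leq_trans (leq_expl c le_nk) _.
  by rewrite -expnM mulnC !expnM leq_expl.
by rewrite leq_exp2l // leqNgt bkac.
Qed.

Lemma not_compat_prime n s k p : s <= 30 -> prime p -> p <= n -> n - p < k ->
  2 * k <= n -> n - p + 30 < p -> ~ compat n s k.
Proof.
move=> s30 pp pn npk kn np cp.
have nE : n %% p = n - p by rewrite -[in LHS](subnK pn) modnDr modn_small //; lia.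
have := compat_prime cp pp; rewrite nE (modn_small (_ : k < p)) => [/(_ _)|]; lia.
Qed.

(* [b / c] bounds the binary logarithm of [k] from above. *)
Lemma not_compat_block n s k K a b c : s <= 30 -> 0 < s -> 2 * k <= n -> 0 < k ->
    K ^ c <= 2 ^ b -> 2 ^ a <= n -> k <= K ->
    b * k < a * c * (k - prime_pi (k + 30)) ->
  ~ compat n s k.
Proof.
move=> s30 s0 kn k0 Kcb an kK; apply: not_compat_exp => //.
exact: leq_trans (leq_expl c kK) Kcb.
Qed.

(** * Certified tables of primes *)

Fixpoint trial (p : N) (l : seq N) : bool :=
  if l is q :: l' then
    if (p <? q * q)%num then true
    else if (p mod q =? 0)%num then false else trial p l'
  else (p <? 728 * 728)%num.

Definition small_primes := [seq N.of_nat q | q <- iota 2 726 & prime q].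
Arguments small_primes : simpl never.

(* [small_primes] contains the primes up to 727, hence the bound in [trial]. *)
Definition trial_division p := (60 <? p)%num && trial p small_primes.

Lemma trial_division_prime p : trial_division p ->
  prime (N.to_nat p) && (60 < N.to_nat p).
Proof.
case/andP=> /N.ltb_lt p1; set P := N.to_nat p; have P60 : 60 < P by rewrite /P; lia.
have P0 : 0 < P by lia.
rewrite P60 andbT.
rewrite /small_primes => h; apply: contraT => npr.
have pdP : pdiv P ^ 2 <= P.
  by rewrite leqNgt; apply: contra npr; apply: ltn_pdiv2_prime.
have dv := pdiv_dvd P; have dpr : prime (pdiv P) by apply: pdiv_prime; rewrite /P; lia.
have q2 := prime_gt1 dpr; move: dpr q2 dv pdP; move: (pdiv P) => d dpr d2 dv ddP.
have : d < 728 -> d \in [seq q <- iota 2 726 | prime q].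
  by move=> d7; rewrite mem_filter dpr mem_iota d2.
have : all (fun q => q < 728) [seq q <- iota 2 726 | prime q].
  by apply/allP => q; rewrite mem_filter mem_iota => /and3P[].
have : sorted ltn [seq q <- iota 2 726 | prime q].
  by apply: sorted_filter; [exact: ltn_trans | exact: iota_ltn_sorted].
elim: [seq _ <- _ | _] h => [|q r IH] /=.
  move=> h _ _ dl; suff /dl : d < 728 by [].
  rewrite -(@ltn_exp2r _ _ 2) // (leq_ltn_trans ddP) // -mulnn.
  by move: h; rewrite /P; clear; lia.
case: ifP => [pq _ qr /andP[q7 r7] dl|_].
  have dq : d < q.
    rewrite -(@ltn_exp2r _ _ 2) // (leq_ltn_trans ddP) // /P -mulnn.
    by move: pq; clear; lia.
  have := dl (ltn_trans dq q7); rewrite inE ltn_eqF //= => dr.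
  by have /= := allP (order_path_min ltn_trans qr) d dr; rewrite ltnNge (ltnW dq).
case: ifP => // pq h qr /andP[_ r7] dl; apply: IH h (path_sorted qr) r7 _ => /dl.
rewrite inE => /orP[/eqP dq|//]; move: pq; rewrite -dq.
have [m mE] := dvdnP dv.
have -> : p = (N.of_nat m * N.of_nat d)%num by rewrite -[p]N2Nat.id -/P mE; lia.
by rewrite N.Div0.mod_mul.
Qed.

Fixpoint covers (d lo hi : N) (ps : seq N) : bool :=
  if ps is p :: ps' then (p <=? lo)%num && covers d (p + d + 1)%num hi ps'
  else (hi <=? lo)%num.

Lemma covers_prime (a : pred N) (P : pred nat) d lo hi ps n :
    (forall p, a p -> P (N.to_nat p)) ->
    covers d lo hi ps -> all a ps -> (lo <= N.of_nat n < hi)%num ->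
  exists p, [/\ P p, p <= n & n - p <= N.to_nat d].
Proof.
move=> aP; elim: ps lo => [|p ps IH] lo /=; first by move=> + _; clear; lia.
move=> /andP[plo cov] /andP[/aP pp tps] nb.
case: (N.leb_spec (p + d + 1) (N.of_nat n)) => h.
  by apply: IH cov tps _; move: h nb; clear; lia.
exists (N.to_nat p); split=> //; first by move: plo nb; clear; lia.
by move: h; clear; lia.
Qed.

(** The prime gap from 1327 to 1361 is too long for windows of length 30: it separates [table1] from
    [table2] and leaves 1358, 1359 and 1360 to [not_compat_small_n]. *)
Definition table1 : seq N := [::
  61; 89; 113; 139; 167; 197; 227; 257; 283; 313; 337; 367; 397; 421; 449;
    479; 509; 523; 547; 577; 607; 631; 661; 691; 719; 743; 773; 797; 827; 857;
    887; 911; 941; 971; 997; 1021; 1051; 1069; 1097; 1123; 1153; 1181; 1201;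
    1231; 1259; 1289; 1319; 1327]%num.
Definition table2 : seq N := [::
  1361; 1381; 1409; 1439; 1459; 1489; 1511; 1531; 1559; 1583; 1613; 1637;
    1667; 1697; 1723; 1753; 1783; 1811; 1831; 1861; 1889; 1913; 1933; 1951;
    1979; 2003; 2029; 2053; 2083; 2113; 2143; 2161; 2179; 2207; 2237; 2267;
    2297; 2311; 2341; 2371; 2399; 2423; 2447; 2477; 2503; 2531; 2557; 2579;
    2609; 2633; 2663; 2693; 2719; 2749; 2777; 2803; 2833; 2861; 2887; 2917;
    2939; 2969; 2999; 3023; 3049; 3079; 3109; 3137; 3167; 3191; 3221; 3251;
    3271; 3301; 3331; 3361; 3391; 3413; 3433; 3463; 3491; 3517; 3547; 3571;
    3593; 3623; 3643; 3673; 3701; 3727; 3739; 3769; 3797; 3823; 3853; 3881;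
    3911; 3931; 3947; 3967; 3989; 4019; 4049; 4079]%num.
Definition table3 : seq N := [::
  4093; 4397; 4691; 4993; 5297; 5591; 5881; 6173; 6473; 6763; 7057; 7351;
    7649; 7951; 8243; 8543; 8839; 9137; 9439; 9743; 10039; 10343; 10639;
    10939; 11243; 11527; 11831; 12119; 12421; 12721; 13009; 13313; 13613;
    13913; 14207; 14503; 14797; 15101; 15401; 15683; 15973; 16273]%num.
Definition table4 : seq N := [::
  16381; 17401; 18413; 19433; 20443; 21467; 22483; 23497; 24517; 25541; 26561;
    27583; 28607; 29629; 30649; 31667; 32687; 33703; 34721; 35731; 36749;
    37747; 38767; 39791; 40813; 41813; 42829; 43853; 44867; 45887; 46901;
    47917; 48907; 49927; 50951; 51973; 52981; 54001; 55021; 56041; 57059;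
    58073; 59093; 60107; 61129; 62143; 63149; 64171; 65183; 66191; 67213;
    68227; 69247; 70271; 71293; 72313; 73331; 74353; 75377; 76387; 77383;
    78401; 79423; 80447; 81463; 82487; 83497; 84521; 85531; 86539; 87559;
    88547; 89567; 90583; 91591; 92593; 93607; 94621; 95633; 96643; 97651;
    98669; 99689; 100703; 101723; 102701; 103723; 104743; 105767; 106787;
    107791; 108803; 109819; 110821; 111833; 112843; 113843; 114859; 115883;
    116903; 117917; 118931; 119953; 120977; 121997; 123017; 124021; 125029;
    126047; 127051; 128053; 129061; 130079; 131101; 132113; 133121; 134129;
    135151; 136163; 137183; 138197; 139201; 140221; 141241; 142237; 143261;
    144271; 145289; 146309; 147331; 148339; 149351; 150373; 151397; 152419;
    153443; 154459; 155473; 156493; 157513; 158537; 159553; 160553; 161573;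
    162593; 163613; 164627; 165617; 166631; 167641; 168643; 169667; 170689;
    171713; 172721; 173743; 174767; 175783; 176807; 177823; 178831; 179849;
    180871; 181891; 182899; 183919; 184913; 185923; 186947; 187963; 188983;
    189997; 191021; 192043; 193057; 194071; 195089; 196111; 197123; 198139;
    199153; 200177; 201193; 202201; 203221; 204233; 205253; 206273; 207293;
    208309; 209333; 210347; 211369; 212383; 213407; 214399; 215417; 216431;
    217439; 218461; 219467; 220471; 221489; 222511; 223529; 224527; 225529;
    226553; 227569; 228593; 229613; 230611; 231631; 232643; 233663; 234683;
    235699; 236723; 237737; 238759; 239783; 240797; 241817; 242819; 243839;
    244861; 245881; 246899; 247913; 248909; 249923; 250919; 251941; 252949;
    253969; 254993; 255989; 257003; 258023; 259033; 260047; 261071; 262079;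
    263101; 264113; 265129; 266153; 267167; 268189; 269209; 270229; 271253;
    272269; 273289; 274301; 275323; 276347; 277363; 278387; 279407; 280411;
    281431; 282439; 283463; 284483; 285497; 286519; 287537; 288559; 289577;
    290597; 291619; 292631; 293651; 294673; 295693; 296713; 297727; 298733;
    299749; 300761; 301759; 302779; 303803; 304813; 305821; 306829; 307843;
    308857; 309877; 310901; 311897; 312899; 313921; 314933; 315949; 316961;
    317983; 319001; 320011; 321031; 322051; 323053; 324073; 325093; 326113;
    327133; 328129; 329143; 330167; 331183; 332207; 333227; 334247; 335261;
    336263; 337283; 338297; 339307; 340321; 341339; 342359; 343381; 344371;
    345379; 346399; 347411; 348433; 349423; 350447; 351469; 352493; 353501;
    354479; 355501; 356509; 357517; 358541; 359563; 360551; 361561; 362581;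
    363589; 364607; 365627; 366631; 367651; 368653; 369673; 370693; 371699;
    372719; 373721; 374741; 375761; 376769; 377789; 378809; 379817; 380839;
    381859; 382883; 383891; 384913; 385927; 386927; 387917; 388937; 389957;
    390967; 391987; 393007; 394019; 395039; 396061; 397073; 398087; 399107;
    400123; 401119; 402139; 403163; 404177; 405199; 406207; 407221; 408241;
    409261; 410281; 411287; 412303; 413299; 414313; 415319; 416333; 417337;
    418357; 419351; 420367; 421381; 422393; 423413; 424433; 425443; 426427;
    427451; 428473; 429497; 430517; 431533; 432557; 433577; 434597; 435619;
    436627; 437651; 438671; 439693; 440717; 441737; 442753; 443777; 444793;
    445807; 446827; 447841; 448859; 449879; 450899; 451921; 452923; 453931;
    454943; 455953; 456959; 457981; 458993; 460013; 461017; 462041; 463033;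
    464047; 465071; 466091; 467101; 468121; 469141; 470161; 471179; 472193;
    473203; 474223; 475243; 476249; 477259; 478273; 479287; 480299; 481307;
    482323; 483347; 484369; 485389; 486407; 487429; 488441; 489457; 490481;
    491503; 492523; 493541; 494563; 495587; 496609; 497633; 498653; 499673;
    500693; 501707; 502729; 503753; 504767; 505781; 506797; 507821; 508841;
    509863; 510847; 511867; 512891; 513899; 514903; 515923; 516947; 517967;
    518989; 519997; 521021; 522037; 523049; 524071]%num.

Lemma tables_ok : [&&
  covers 30 62 1358 table1, covers 30 1361 4096 table2,
  covers 304 4096 (2 ^ 14)%num table3, covers 1024 (2 ^ 14)%num (2 ^ 19)%num table4 &
  all trial_division
    (table1 ++ table2 ++ table3 ++ table4)].
Proof. by vm_compute. Qed.

(** The condition [n - p + 30 < p] follows from [60 < p] when [d <= 30], and from [4096 <= n] when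
    [d <= 1024]. *)
Lemma not_compat_near_prime n s k d : s <= 30 -> 2 * k <= n -> 30 < k -> d < k ->
    (d < 31 \/ 2 ^ 12 <= n /\ d < 1025) ->
    (exists p, [/\ prime p && (60 < p), p <= n & n - p <= d]) ->
  ~ compat n s k.
Proof.
move=> s30 kn k30 dk hd [p [/andP[pp p60] pn npd]].
apply: (not_compat_prime s30 pp pn) => //; first by move: npd dk; clear; lia.
have : d < 31 \/ 4 * 1024 <= n /\ d < 1025 by rewrite (_ : 4 * 1024 = 2 ^ 12) //; lia.
by move: p60 pn npd dk kn k30; clear; lia.
Qed.

Lemma not_compat_small_n n s k : 0 < s <= 30 -> 2 * k <= n -> 30 < k -> n < 2 ^ 12 ->
  ~ compat n s k.
Proof.
move=> /andP[s0 s30] kn k30 n12.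
have {n12} nb : (62 <= N.of_nat n < 4096)%num.
  have : n < 4 * 1024 by apply: leq_trans n12 _; lia.
  by move: kn k30; clear; lia.
have H := @not_compat_near_prime n s k (N.to_nat 30) s30 kn k30 k30 (or_introl isT).
have [cov1 cov2 _ _] := and5P tables_ok; rewrite !all_cat => /and4P[t1 t2 _ _].
case: (N.ltb_spec (N.of_nat n) 1358) => n1.
  have nb1 : (62 <= N.of_nat n < 1358)%num by move: nb n1; clear; lia.
  exact/H/(covers_prime trial_division_prime cov1 t1 nb1).
case: (N.leb_spec 1361 (N.of_nat n)) => n2.
  have nb2 : (1361 <= N.of_nat n < 4096)%num by move: nb n2; clear; lia.
  exact/H/(covers_prime trial_division_prime cov2 t2 nb2).
(* For [k > 33] the prime 1327 is still within reach of 1360; for the remaining [k] the prime 97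
   serves, as [14 * 97 = 1358]. *)
case: (ltnP 33 k) => k33.
  have /andP[pp _] : prime (N.to_nat 1327) && (60 < N.to_nat 1327).
    by apply: trial_division_prime; vm_compute.
  apply: (not_compat_prime s30 pp _ _ kn); move: n1 n2 k33; clear; lia.
move=> cp; have [r rn r3] : exists2 r, n = 14 * 97 + r & r < 3.
  by exists (n - N.to_nat 1358); move: n1 n2; clear; lia.
have p97 : prime 97 by [].
have nE : n %% 97 = r.
  by rewrite rn modnMDl; apply: modn_small; apply: leq_trans r3 _.
have := compat_prime cp p97; rewrite nE (modn_small (_ : k < 97)).
  by move=> /(_ _); move: r3 k30 s30; clear; lia.
by move: k33; clear; lia.
Qed.

Lemma not_compat_mid n s k : 0 < s <= 30 -> 2 * k <= n -> 30 < k -> k <= 11 ^ 4 ->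
  ~ compat n s k.
Proof.
move=> sr kn k30 kbig; have /andP[s0 s30] := sr.
case: (ltnP n (2 ^ 12)) => n12; first exact: not_compat_small_n.
have [_ _ cov3 cov4 tab] := and5P tables_ok.
move: tab; rewrite !all_cat => /and4P[_ _ t3 t4].
have pi_le := prime_pi_leq (k + 30).
(* For these [k] the estimate has almost no slack, so [prime_pi_leq] is supplemented by exact
   counts. *)
have pi61 : k <= 31 -> prime_pi (k + 30) <= 17.
  rewrite -(leq_add2r 30) => /leq_prime_pi kle; apply: leq_trans kle _.
  by rewrite prime_piE; vm_compute; exact: isT.
have pi66 : k <= 36 -> prime_pi (k + 30) <= 18.
  rewrite -(leq_add2r 30) => /leq_prime_pi kle; apply: leq_trans kle _.
  by rewrite prime_piE; vm_compute; exact: isT.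
have block a (an : 2 ^ a <= n) K b c : k <= K -> K ^ c <= 2 ^ b ->
    b * k < a * c * (k - prime_pi (k + 30)) -> ~ compat n s k.
  move=> kK Kcb; apply: (not_compat_block s30 s0 kn (ltn_trans _ k30) Kcb an kK).
  exact: isT.
move: (prime_pi _) pi_le pi61 pi66 block => P pi_le pi61 pi66 block.
have small_c b c a : b * k < a * c * (k - P) = (b * k + a * c * P < a * c * k).
  by case: (leqP P k) => h; rewrite ?mulnBr; move: (leq_mul (leqnn (a * c)) h); clear; nia.
have {small_c}blk a (an : 2 ^ a <= n) K b c : b * k + a * c * P < a * c * k ->
    K ^ c <= 2 ^ b -> k <= K -> ~ compat n s k.
  by rewrite -small_c => hk Kcb kK; apply: (block a an K b c).
clear block.
(* The bounds 304 and 1024 are the window lengths of [table3] and [table4]: up to each of them the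
   logarithmic estimate suffices for the [n] not yet covered, and beyond it the table applies. *)
case: (leqP k 304) => k304.
  move/(_ 12 n12): blk; clear n12 => blk.
  case: (leqP k 31) => k31.
    by apply: (blk 31 15 3 _ _ k31); [move: (pi61 k31) k30 (k31) | ]; clear; lia.
  case: (leqP k 32) => k32.
    have k36 := leq_trans k32 (isT : 32 <= 36).
    by apply: (blk 32 5 1 _ _ k32); [move: (pi66 k36) k31 k32 | ]; clear; lia.
  case: (leqP k 36) => k36.
    by apply: (blk 40 16 3); [move: (pi66 k36) k32 | | move: k36]; clear; lia.
  case: (leqP k 40) => k40.
    by apply: (blk 40 16 3 _ _ k40); [move: pi_le k36 k40 | ]; clear; lia.
  case: (leqP k 48) => k48.
    by apply: (blk 48 28 5 _ _ k48); [move: pi_le k40 k48 | ]; clear; lia.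
  case: (leqP k 64) => k64.
    by apply: (blk 64 6 1 _ _ k64); [move: pi_le k48 k64 | ]; clear; lia.
  case: (leqP k 80) => k80.
    by apply: (blk 80 19 3 _ _ k80); [move: pi_le k64 k80 | ]; clear; lia.
  case: (leqP k 128) => k128.
    by apply: (blk 128 7 1 _ _ k128); [move: pi_le k80 k128 | ]; clear; lia.
  case: (leqP k 181) => k181.
    by apply: (blk 181 15 2 _ _ k181); [move: pi_le k128 k181 | ]; clear; lia.
  case: (leqP k 256) => k256.
    by apply: (blk 256 8 1 _ _ k256); [move: pi_le k181 k256 | ]; clear; lia.
  by apply: (blk 304 33 4 _ _ k304); [move: pi_le k256 k304 | ]; clear; lia.
case: (ltnP n (2 ^ 14)) => n14.
  apply: (not_compat_near_prime s30 kn k30 (_ : N.to_nat 304 < k) (or_intror (conj n12 _))).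
  - by move: k304; clear; lia.
  - by clear; lia.
  apply: (covers_prime trial_division_prime cov3 t3).
  by move: n12 n14; clear; lia.
case: (leqP k 1024) => k1024.
  move/(_ 14 n14): blk; clear n14 => blk.
  case: (leqP k 512) => k512.
    by apply: (blk 512 9 1 _ _ k512); [move: pi_le k304 k512 | ]; clear; lia.
  case: (leqP k 724) => k724.
    by apply: (blk 724 19 2 _ _ k724); [move: pi_le k512 k724 | ]; clear; lia.
  by apply: (blk 1024 10 1 _ _ k1024); [move: pi_le k724 k1024 | ]; clear; lia.
case: (ltnP n (2 ^ 19)) => n19.
  apply: (not_compat_near_prime s30 kn k30 (_ : N.to_nat 1024 < k) (or_intror (conj n12 _))).
  - by move: k1024; clear; lia.
  - by clear; lia.
  apply: (covers_prime trial_division_prime cov4 t4).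
  by move: n14 n19; clear; lia.
move/(_ 19 n19): blk; clear n19 => blk.
case: (leqP k (N.to_nat 2048)) => k2048.
  by apply: (blk (N.to_nat 2048) 11 1 _ _ k2048); [move: pi_le k1024 k2048 | ]; clear; lia.
case: (leqP k (N.to_nat 4096)) => k4096.
  by apply: (blk (N.to_nat 4096) 12 1 _ _ k4096); [move: pi_le k2048 k4096 | ]; clear; lia.
case: (leqP k (N.to_nat 8192)) => k8192.
  by apply: (blk (N.to_nat 8192) 13 1 _ _ k8192); [move: pi_le k4096 k8192 | ]; clear; lia.
case: (leqP k (N.to_nat 11585)) => k11585.
  by apply: (blk (N.to_nat 11585) 27 2 _ _ k11585); [move: pi_le k8192 k11585 | ]; clear; lia.
by apply: (blk (11 ^ 4) 97 7 _ _ kbig); [move: pi_le k11585 kbig | ]; clear; lia.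
Qed.

(** * Verified computation of Newton polygons *)

Lemma of_natD a b : N.of_nat (a + b) = (N.of_nat a + N.of_nat b)%num.
Proof. lia. Qed.

Lemma of_natM a b : N.of_nat (a * b) = (N.of_nat a * N.of_nat b)%num.
Proof. lia. Qed.

Lemma of_nat_mod a b : (N.of_nat a mod N.of_nat b)%num = N.of_nat (a %% b).
Proof.
case: b => [|b]; first by rewrite modn0; case: (N.of_nat a).
symmetry; apply: (N.mod_unique _ _ (N.of_nat (a %/ b.+1))).
  by have := ltn_pmod a (isT : 0 < b.+1); move: (_ %% _) => r; clear; lia.
by rewrite {1}(divn_eq a b.+1) of_natD of_natM N.mul_comm.
Qed.

Lemma ltb_of_nat a b : (N.of_nat a <? N.of_nat b)%num = (a < b).
Proof. by apply/idP/idP; lia. Qed.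

(** No carry is possible at a power [q] exceeding [a + b], so the test is finite; lack of fuel gives
    the safe answer. Conditionals replace conjunctions to avoid needless evaluation under
    [vm_compute]. *)
Fixpoint nocarryb (fuel : nat) (p a b q : N) : bool :=
  if (a + b <? q)%num then true
  else if fuel is f.+1 then
    if (a mod q + b mod q <? q)%num then nocarryb f p a b (q * p)%num else false
  else false.

Lemma nocarrybP fuel p a b t0 : 0 < p ->
    nocarryb fuel (N.of_nat p) (N.of_nat a) (N.of_nat b) (N.of_nat (p ^ t0)) ->
  forall t, t0 <= t -> a %% p ^ t + b %% p ^ t < p ^ t.
Proof.
move=> p0 + t; have small t1 : t1 <= t ->
    (N.of_nat a + N.of_nat b <? N.of_nat (p ^ t1))%num -> a %% p ^ t + b %% p ^ t < p ^ t.
  rewrite -of_natD ltb_of_nat => tt h.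
  have ab : a + b < p ^ t by apply: leq_trans h (leq_pexp2l p0 tt).
  by rewrite !modn_small //; move: ab; clear; lia.
elim: fuel t0 => [|f IH] t0 /=; first by case: ifP => // h _ /small; apply.
case: ifP => [h _ /small|_]; first exact.
rewrite !of_nat_mod -of_natD ltb_of_nat -of_natM -expnSr.
case: ifP => // h hf; rewrite leq_eqVlt => /orP[/eqP<-//|]; exact: IH.
Qed.

Definition nocarryN (p a b : N) := nocarryb 45 p a b p.

Lemma nocarryNP p a b : 0 < p ->
  nocarryN (N.of_nat p) (N.of_nat a) (N.of_nat b) -> nocarry p a b.
Proof.
move=> p0 h [|t]; first by rewrite !modn1.
by apply: (@nocarrybP 45 p a b 1); rewrite ?expn1.
Qed.

Fixpoint exceedsb (fuel : nat) (p n k q : N) : bool :=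
  if fuel is f.+1 then
    if (n mod q <? k mod q)%num then true else exceedsb f p n k (q * p)%num
  else false.

Lemma exceedsbP fuel p n k t0 :
    exceedsb fuel (N.of_nat p) (N.of_nat n) (N.of_nat k) (N.of_nat (p ^ t0)) ->
  exists t, n %% p ^ t < k %% p ^ t.
Proof.
elim: fuel t0 => // f IH t0 /=.
by rewrite !of_nat_mod ltb_of_nat -of_natM -expnSr; case: ifP => [h _|_ /IH//]; exists t0.
Qed.

Fixpoint lognN (fuel : nat) (p m : N) : N :=
  if fuel is f.+1 then
    if N.div_eucl m p is (d, 0%num) then N.succ (lognN f p d) else 0%num
  else 0%num.

Lemma div_eucl_of_nat m p : 0 < p ->
  N.div_eucl (N.of_nat m) (N.of_nat p) = (N.of_nat (m %/ p), N.of_nat (m %% p)).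
Proof.
move=> p0; rewrite -of_nat_mod [LHS]surjective_pairing; congr (_, _).
rewrite -[LHS]/(N.of_nat m / N.of_nat p)%num.
symmetry; apply: (N.div_unique _ _ _ (N.of_nat (m %% p))).
  by have := ltn_pmod m p0; move: (_ %% _) => r; clear; lia.
by rewrite {1}(divn_eq m p) of_natD of_natM N.mul_comm.
Qed.

Lemma lognNP fuel p m : prime p -> 0 < m < 2 ^ fuel ->
  lognN fuel (N.of_nat p) (N.of_nat m) = N.of_nat (logn p m).
Proof.
move=> pp; elim: fuel m => [|f IH] m /andP[m0 mf].
  by move: m0 mf; rewrite expn0; clear; lia.
have p1 := prime_gt1 pp; rewrite /lognN -/lognN.
rewrite div_eucl_of_nat ?(ltnW p1) //.
case mp: (m %% p) => [|r] /=; last first.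
  rewrite lognE pp m0 /= /dvdn mp //.
have dv : p %| m by rewrite /dvdn mp.
rewrite IH; last first.
  rewrite divn_gt0 ?(ltnW p1) // dvdn_leq //= ltn_divLR ?(ltnW p1) //.
  by rewrite (leq_trans mf) // expnS mulnC leq_mul2l p1 orbT.
by rewrite [in RHS]lognE pp m0 dv /=; clear; lia.
Qed.

(** Descending from the leading coefficient 1, valuations are updated from small numbers only,
    without computing any coefficient. *)
Lemma acoef_rec n s i : i < n ->
  acoef n s (n - i.+1) * i.+1 = acoef n s (n - i) * (n - i) * (s + i.+1).
Proof.
move=> ilt; have acoefE j : j <= n -> acoef n s (n - j) = 'C(n, j) * (s + j) ^_ j.
  move=> jn; rewrite /acoef bin_sub // subKn //; congr (_ * _ ^_ _); lia.
rewrite !acoefE //; last exact: ltnW.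
rewrite addnS ffactSS mulnAC [_ * i.+1]mulnC mul_bin_left.
move: ('C(n, i)) ((s + i) ^_ i) => a b; clear; nia.
Qed.

Fixpoint valuations (fuel : nat) (p n s i v : N) : seq (N * N) :=
  ((n - i)%num, v) ::
  if fuel is f.+1 then
    valuations f p n s (i + 1)%num
      (v + lognN 20 p (n - i) + lognN 20 p (s + i + 1) - lognN 20 p (i + 1))%num
  else [::].

Lemma valuationsP p n s i f : prime p -> i + f = n -> n + s < 2 ^ 20 ->
  forall j, j <= f ->
  (N.of_nat j, N.of_nat (logn p (acoef n s j))) \in
    valuations f (N.of_nat p) (N.of_nat n) (N.of_nat s) (N.of_nat i)
      (N.of_nat (logn p (acoef n s (n - i)))).
Proof.
move=> pp + ns; elim: f i => [|f IH] i ifn j jf.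
  have -> : j = n - i by move: ifn jf; clear; lia.
  by rewrite /= inE; apply/eqP; congr (_, _); clear; lia.
move: jf; rewrite leq_eqVlt => /orP[/eqP jE|jf].
  have -> : j = n - i by move: ifn jE; clear; lia.
  rewrite /= inE; apply/orP; left; apply/eqP; congr (_, _); clear; lia.
rewrite [valuations]lock /= -lock /valuations -/valuations inE; apply/orP; right.
have ilt : i < n by move: ifn; clear; lia.
have -> : (N.of_nat n - N.of_nat i = N.of_nat (n - i))%num by clear; lia.
have -> : (N.of_nat s + N.of_nat i + 1 = N.of_nat (s + i.+1))%num by clear; lia.
have -> : (N.of_nat i + 1 = N.of_nat i.+1)%num by clear; lia.
have bound m : 0 < m <= n + s -> 0 < m < 2 ^ 20.
  by case/andP=> -> /leq_ltn_trans -> //.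
rewrite !lognNP //; try by apply: bound; move: ilt; clear; lia.
have -> : (N.of_nat (logn p (acoef n s (n - i))) + N.of_nat (logn p (n - i)) +
    N.of_nat (logn p (s + i.+1)) - N.of_nat (logn p i.+1) =
    N.of_nat (logn p (acoef n s (n - i.+1))))%num.
  have := congr1 (logn p) (acoef_rec s ilt).
  have a1 : 0 < acoef n s (n - i) by apply: acoef_gt0; rewrite leq_subr.
  have a2 : 0 < acoef n s (n - i.+1) by apply: acoef_gt0; rewrite leq_subr.
  have a3 : 0 < n - i by rewrite subn_gt0.
  have a4 : 0 < s + i.+1 by rewrite addnS.
  have a5 : 0 < acoef n s (n - i) * (n - i) by rewrite muln_gt0 a1.
  by rewrite (lognM _ a2) // (lognM _ a5) // (lognM _ a1) //; clear; lia.
by apply: IH => //; rewrite addSnnS.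
Qed.

(* An edge [(u, q, z, m)] has slope [- u / q], right end [z] and weight [m]. *)
Definition on_or_above (x : N) (e : N * N * N * N) (P : N * N) : bool :=
  let: (u, q, z, m) := e in let: (j, v) := P in
  let w := (q * v + u * j)%num in
  if ((j <? x) || (z <? j))%num then (m <? w)%num
  else if ((j =? x) || (j =? z))%num then (w =? m)%num else (m <=? w)%num.

Fixpoint newtonb (V : seq (N * N)) (n x : N) (es : seq (N * N * N * N)) : bool :=
  if es is (u, q, z, m) :: es' then
    [&& (0 <? q)%num, (N.gcd u q =? 1)%num, (x <=? z)%num, (z <=? n)%num,
        (if es' is (u', q', _, _) :: _ then (u' * q <? u * q')%num else true),
        all (on_or_above x (u, q, z, m)) V & newtonb V n z es']
  else (x =? n)%num.

Definition nat_edge (e : N * N * N * N) : nat * nat * nat :=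
  let: (u, q, z, _) := e in (N.to_nat u, N.to_nat q, N.to_nat z).

Lemma on_or_aboveP x u q z m j v :
    on_or_above x (u, q, z, m) (N.of_nat j, N.of_nat v) -> (x <= z)%num ->
  let w := N.to_nat q * v + N.to_nat u * j in
  [/\ N.to_nat m + (j < N.to_nat x) <= w, N.to_nat m + (N.to_nat z < j) <= w &
      j = N.to_nat x \/ j = N.to_nat z -> w = N.to_nat m].
Proof.
have wE : N.to_nat (q * N.of_nat v + u * N.of_nat j)%num = N.to_nat q * v + N.to_nat u * j.
  by clear; lia.
rewrite /on_or_above; move: wE; move: (_ + u * _)%num (_ + _ * j) => w w' <-.
case: ifP => h1; first by move=> h xz; split; move: h1 h xz; clear; lia.
by case: ifP => h2 h xz; split; move: h1 h2 h xz; clear; lia.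
Qed.

Lemma coprime_of_gcd a b : (N.gcd a b =? 1)%num -> coprime (N.to_nat a) (N.to_nat b).
Proof.
move=> /N.eqb_eq g1; set d := gcdn (N.to_nat a) (N.to_nat b).
have dv c : d %| N.to_nat c -> N.divide (N.of_nat d) c.
  by case/dvdnP=> m mE; exists (N.of_nat m); rewrite -of_natM -mE N2Nat.id.
have := N.gcd_greatest a b _ (dv a (dvdn_gcdl _ _)) (dv b (dvdn_gcdr _ _)).
by rewrite g1 => /N.divide_1_r; rewrite /coprime -/d; clear; lia.
Qed.

Lemma newtonbP p n s V x es : prime p ->
    (forall j, j <= n -> (N.of_nat j, N.of_nat (logn p (acoef n s j))) \in V) ->
    newtonb V (N.of_nat n) x es ->
  newton p (gpoly n s) (N.to_nat x) [seq nat_edge e | e <- es].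
Proof.
move=> pp HV; elim: es x => [|[[[u q] z] m] es IH] x.
  by move/N.eqb_eq => /= ->; rewrite Nat2N.id size_gpoly.
rewrite [newtonb _ _ _ _]/=; case/and5P=> q0 cuq /N.leb_le xz zn /and3P[sl /allP ab nw].
have xn' : N.to_nat x <= n by move: xz zn; clear; lia.
have zn' : N.to_nat z <= n by move: zn; clear; lia.
have [_ _ /(_ (or_introl erefl)) wx] := on_or_aboveP (ab _ (HV _ xn')) xz.
have [_ _ /(_ (or_intror erefl)) wz] := on_or_aboveP (ab _ (HV _ zn')) xz.
rewrite [map _ _]/= /newton -/newton; split.
- by split; [move: q0; clear; lia | apply: coprime_of_gcd].
- apply: edge_end_gpoly => // j /HV/ab/on_or_aboveP/(_ xz)[h _ _].
  by rewrite wx.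
- apply: edge_end_gpoly => // j /HV/ab/on_or_aboveP/(_ xz)[_ h _].
  by rewrite wz.
- move: sl; case: (es) => [|[[[u' q'] z'] m'] es'] //=; clear; lia.
- exact: IH nw.
Qed.

(* Lower convex hull by monotone chain, the points coming by decreasing
   abscissa; its output is checked afterwards, so nothing is proved about it. *)
Fixpoint push (P : N * N) (st : seq (N * N)) : seq (N * N) :=
  if st is A :: ((B :: _) as st') then
    let: (xc, yc) := P in let: (xa, ya) := A in let: (xb, yb) := B in
    if (yc * (xb - xa) + yb * (xa - xc) <=? ya * (xb - xc))%num then push P st'
    else P :: st
  else P :: st.

Fixpoint hull_edges (st : seq (N * N)) : seq (N * N * N * N) :=
  if st is (x, v) :: (((z, w) :: _) as st') then
    let d := N.gcd (z - x) (v - w) in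
    let u := ((v - w) / d)%num in let q := ((z - x) / d)%num in
    (u, q, z, q * v + u * x)%num :: hull_edges st'
  else [::].

Fixpoint unreachable (es : seq (N * N * N * N)) (ts : seq N) (x a k : N) : bool :=
  if es is (_, q, z, _) :: es' then
    all (fun t => if (z - x <? t * q)%num then true else
                  if (k <? a + t * q)%num then true
                  else unreachable es' ts z (a + t * q)%num k) ts
  else negb (a =? k)%num.

Lemma reach_leq es x a k : reach es x a k -> a <= k.
Proof.
elim: es x a => [|[[u q] z] es IH] x a /=; first by move->.
by case=> t _ /IH; apply: leq_trans; rewrite leq_addr.
Qed.

Lemma unreachableP es ts x a k :
    (forall t, t <= k -> N.of_nat t \in ts) -> all (fun e => (0 < (nat_edge e).1.2)) es ->
    unreachable es ts x (N.of_nat a) (N.of_nat k) ->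
  ~ reach [seq nat_edge e | e <- es] (N.to_nat x) a k.
Proof.
move=> Hts; elim: es x a => [|[[[u q] z] m] es IH] x a.
  by move=> _ /= h ak; move: h; rewrite ak N.eqb_refl.
case/andP=> q0 es0; rewrite [unreachable _ _ _ _ _]/= [map _ _]/= => /allP h.
rewrite /reach -/reach => -[t tz r]; have := reach_leq r => tk.
have tk' : t <= k by move: tk q0 => /=; clear; nia.
have := h _ (Hts t tk'); case: ifP => [|_]; first by move: tz; clear; lia.
case: ifP => [|_]; first by move: tk; clear; lia.
have -> : (N.of_nat a + N.of_nat t * q = N.of_nat (a + t * N.to_nat q))%num by clear; lia.
by move/(IH _ _ es0).
Qed.

Definition newton_check (n s p k : N) : bool :=
  let V := valuations (N.to_nat n) p n s 0 0 in
  let es := hull_edges (foldl (fun st P => push P st) [::] V) in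
  [&& (n + s <? 2 ^ 20)%num, (if es is [::] then false else true), newtonb V n 0 es &
      unreachable es [seq N.of_nat t | t <- iota 0 (N.to_nat k).+1] 0 0 k].

Lemma newton_checkP n s p k f g : prime p ->
    newton_check (N.of_nat n) (N.of_nat s) (N.of_nat p) (N.of_nat k) ->
  gpoly n s = (f * g)%R -> (size f).-1 <> k.
Proof.
move=> pp; rewrite /newton_check; set V := valuations _ _ _ _ _ _.
move: (hull_edges _) => es /and4P[ns es0 nw un] fg szk.
have HV j : j <= n -> (N.of_nat j, N.of_nat (logn p (acoef n s j))) \in V.
  move=> jn; have := @valuationsP p n s 0 n pp (add0n n) _ j jn.
  rewrite /V Nat2N.id subn0.
  have -> : logn p (acoef n s n) = 0 by rewrite /acoef binn subnn ffactn0 muln1 logn1.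
  apply; move: ns; rewrite -of_natD (_ : (2 ^ 20)%num = N.of_nat (2 ^ 20)); last by clear; lia.
  by rewrite ltb_of_nat.
have := newtonbP pp HV nw; rewrite fg.
move: es0 nw un; case: es => // -[[[u q] z] m] es _ nw un nwP.
have fg0 : (f * g != 0)%R by rewrite -fg -size_poly_gt0 size_gpoly.
have := newton_factor_deg pp fg0 nwP; rewrite szk.
apply: (@unreachableP ((u, q, z, m) :: es) _ 0%num 0 k _ _ un).
  move=> t tk; apply: map_f; rewrite mem_iota add0n ltnS.
  by move: tk; clear; lia.
elim: ((u, q, z, m) :: es) 0%num nw => // -[[[u' q'] z'] m'] es' IH x.
rewrite [newtonb _ _ _ _]/= => /and5P[q0 _ _ _ /and3P[_ _ /IH]].
by rewrite /= => ->; rewrite andbT; move: q0; clear; lia.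
Qed.

(** Above position [e] the digits of [b] vanish and no carry arrives from below. *)
Lemma nocarry_lift p e a b : 0 < p -> b < p ^ e -> a %% p ^ e + b < p ^ e ->
  (forall t, t < e -> a %% p ^ t + b %% p ^ t < p ^ t) -> nocarry p a b.
Proof.
move=> p0 be abe low t; case: (ltnP t e) => [/low//|et].
have q0 i : 0 < p ^ i by rewrite expn_gt0 p0.
have bt : b < p ^ t by apply: leq_trans be _; rewrite leq_pexp2l.
rewrite (modn_small bt).
have tE : p ^ t = p ^ (t - e) * p ^ e by rewrite -expnD subnK.
have -> : a %% p ^ t = (a %/ p ^ e) %% p ^ (t - e) * p ^ e + a %% p ^ e.
  rewrite [in LHS](divn_eq a (p ^ e)) tE.
  rewrite {1}(divn_eq (a %/ p ^ e) (p ^ (t - e))) mulnDl -addnA -mulnA modnMDl modn_small //.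
  by have := ltn_pmod (a %/ p ^ e) (q0 (t - e)); have := ltn_pmod a (q0 e); nia.
by rewrite tE; have := ltn_pmod (a %/ p ^ e) (q0 (t - e)); nia.
Qed.

Lemma nocarry_dvd p e a b : 0 < p -> p ^ e %| a -> b < p ^ e -> nocarry p a b.
Proof.
move=> p0 pa be; apply: (nocarry_lift (e := e)) => //; first by rewrite (eqP pa).
move=> t te; have /eqP-> : a %% p ^ t == 0.
  by rewrite -/(dvdn _ _) (dvdn_trans _ pa) ?dvdn_exp2l // ltnW.
by rewrite ltn_pmod // expn_gt0 p0.
Qed.

(** If the exact power exceeded 30, the low digits of [n] would be zero: no carry with [s], and [k]
    would have to be [0] modulo that power. *)
Lemma compat_pfactor_leq n s k p : 0 < s <= 30 -> 0 < k <= 30 -> compat n s k ->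
  prime p -> 0 < n -> p ^ logn p n <= 30.
Proof.
move=> /andP[_ s30] /andP[k0 k30] cp pp n0; rewrite leqNgt; apply/negP => big.
have dv := pfactor_dvdnn p n.
have nc := nocarry_dvd (prime_gt0 pp) dv (leq_ltn_trans s30 big).
have := cp p pp nc (logn p n); rewrite (eqP dv) leqn0 modn_small; first by case: k k0 {k30 cp}.
exact: leq_ltn_trans k30 big.
Qed.

Lemma compat_dvd_sqr n s k p : s <= 30 -> compat n s k -> prime p -> 30 < p ^ 2 ->
  p %| n -> n %% p ^ 2 + 30 < p ^ 2 -> p %| k.
Proof.
move=> s30 cp pp p30 pn np; have p0 := prime_gt0 pp.
have nc : nocarry p n s.
  apply: (nocarry_lift (e := 2)) => //; first exact: leq_ltn_trans s30 p30.
    by apply: leq_ltn_trans np; rewrite leq_add2l.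
  move=> [|[|//]] _; first by rewrite !modn1.
  by rewrite expn1 (eqP pn) ltn_pmod.
by have := cp p pp nc 1; rewrite expn1 (eqP pn) leqn0.
Qed.

(** * Enumeration of the integers whose exact prime powers are at most 30 *)

Fixpoint all_products (ls : seq (seq N)) (acc : N) (chk : pred N) : bool :=
  if ls is l :: ls' then all (fun q => all_products ls' (q * acc)%num chk) l
  else chk acc.

Lemma all_productsP ls acc chk : all_products ls acc chk ->
  forall v, all2 (fun l q => q \in l) ls v -> chk (foldl (fun m q => q * m)%num acc v).
Proof.
elim: ls acc => [|l ls IH] acc /=; first by move=> h [].
move=> /allP h [|q v] //= /andP[ql hv]; exact: IH (h q ql) _ hv.
Qed.

Definition prime_powers : seq (seq N) :=
  [:: [:: 1; 29]; [:: 1; 23]; [:: 1; 19]; [:: 1; 17]; [:: 1; 13]; [:: 1; 11];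
      [:: 1; 7]; [:: 1; 5; 25]; [:: 1; 3; 9; 27]; [:: 1; 2; 4; 8; 16]]%num.

Lemma all_products_prime_powers n chk : 0 < n ->
    (forall p, prime p -> p ^ logn p n <= 30) ->
  all_products prime_powers 1 chk -> chk (N.of_nat n).
Proof.
move=> n0 H /all_productsP hchk.
have pn p : prime p -> p %| n -> p < 31.
  move=> pp dp; have l0 : 0 < logn p n by rewrite logn_gt0 mem_primes pp n0.
  rewrite ltnS; apply: leq_trans (H p pp).
  by rewrite -[leqLHS]expn1 leq_pexp2l // prime_gt0.
have nE := prod_logn n0 pn.
pose vs := [seq N.of_nat (p ^ logn p n) | p <- [:: 29; 23; 19; 17; 13; 11; 7; 5; 3; 2]].
have -> : N.of_nat n = foldl (fun m q => q * m)%num 1%num vs.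
  rewrite {1}nE -big_filter.
  have -> : [seq p <- index_iota 0 31 | prime p] = [:: 2; 3; 5; 7; 11; 13; 17; 19; 23; 29].
    by vm_compute.
  have ofM a b : N.of_nat (a * b) = (N.of_nat a * N.of_nat b)%num by lia.
  by rewrite !big_cons big_nil !ofM.
apply: hchk; rewrite /vs /=.
have mem p (l : seq N) : prime p ->
    all (fun e => (30 < p ^ e) || (N.of_nat (p ^ e) \in l)) (iota 0 6) ->
    N.of_nat (p ^ logn p n) \in l.
  move=> pp /allP al; have le := H p pp.
  have := al (logn p n); rewrite ltnNge le; apply.
  rewrite mem_iota /=; have := leq_trans (leq_expl (logn p n) (prime_gt1 pp)) le.
  rewrite -[30]/(2 ^ 5 - 2) => h; rewrite ltnNge; apply/negP => h6.
  by have := leq_pexp2l (isT : 0 < 2) h6; move: h; clear; lia.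
by rewrite !mem // unlock.
Qed.

(** * Small degrees *)

Lemma linear_factor_root n s (f g : {poly int}) : gpoly n s = (f * g)%R ->
  (size f).-1 = 1 -> exists x, root (gpoly n s) x.
Proof.
move=> fg sf; have lc : (lead_coef f * lead_coef g = 1)%R.
  rewrite -lead_coefM -fg lead_coefE size_gpoly coef_gpoly //.
  by rewrite /acoef binn subnn ffactn0.
have lf : (lead_coef f * lead_coef f = 1)%R.
  have /intUnitRing.unitzPl : (lead_coef g * lead_coef f = 1)%R by rewrite mulrC.
  by rewrite qualifE /= => /orP[]/eqP->.
(* The leading coefficient of [f] is a unit of the integers, hence its own inverse. *)
exists (- (lead_coef f * f`_0))%R.
rewrite fg rootM; apply/orP; left; apply/rootP.
have szf : size f = 2 by lia.
rewrite horner_coef szf !big_ord_recl big_ord0 /= expr0 expr1 mulr1 addr0.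
have -> : (f`_1 = lead_coef f)%R by rewrite lead_coefE szf.
by rewrite mulrN mulrA lf mul1r subrr.
Qed.

(** The pair that [no_linear_factor] leaves to a direct argument: the cubic has no root modulo 5. *)
Lemma gpoly_3_26_no_root (x : int) : ~~ root (gpoly 3 26) x.
Proof.
apply/negP => /rootP; rewrite horner_poly !big_ord_recl big_ord0 /=.
have -> : acoef 3 26 0 = 29 * 28 * 27.
  by rewrite -[LHS]/('C(3, 0) * 29 ^_ 3) ?bin0 ?bin1 ?bin2 ?binn !ffactnS ffactn0; lia.
have -> : acoef 3 26 1 = 3 * 28 * 27.
  by rewrite -[LHS]/('C(3, 1) * 28 ^_ 2) ?bin0 ?bin1 ?bin2 ?binn !ffactnS ffactn0; lia.
have -> : acoef 3 26 2 = 3 * 27.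
  by rewrite -[LHS]/('C(3, 2) * 27 ^_ 1) ?bin0 ?bin1 ?bin2 ?binn !ffactnS ffactn0; lia.
have -> : acoef 3 26 3 = 1 by [].
have [m [r [-> r5]]] : exists m, exists r, x = (m * 5 + r)%R /\ (0 <= r < 5)%R.
  by exists (x %/ 5)%Z, (x %% 5)%Z; rewrite -divz_eq modz_ge0 // ltz_pmod.
rewrite /bump /= !exprS !expr0 mulr1.
have : (r = 0 \/ r = 1 \/ r = 2 \/ r = 3 \/ r = 4)%R by lia.
by case=> [->|[->|[->|[->|->]]]]; lia.
Qed.

(** * Computable criteria for degrees at most 30 *)

Definition primes_lt61 : seq N :=
  [:: 2; 3; 5; 7; 11; 13; 17; 19; 23; 29; 31; 37; 41; 43; 47; 53; 59]%num.

Lemma primes_lt61P p : p < 61 -> prime p = (N.of_nat p \in primes_lt61).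
Proof.
move=> p61; have : all (fun p => prime p == (N.of_nat p \in primes_lt61)) (iota 0 61).
  by vm_compute.
by move/allP/(_ p); rewrite mem_iota => /(_ p61)/eqP.
Qed.

(* The answer [1] when the fuel runs out is the harmless one. *)
Fixpoint strip (fuel : nat) (p m : N) : N :=
  if fuel is f.+1 then
    if N.div_eucl m p is (d, 0%num) then strip f p d else m
  else 1%num.

Lemma stripP fuel p m : 0 < p ->
  exists2 c, strip fuel (N.of_nat p) (N.of_nat m) = N.of_nat c &
    c = 1 \/ c %| m /\ ~~ (p %| c).
Proof.
move=> p0; elim: fuel m => [|f IH] m; first by exists 1; [|left].
rewrite /strip -/strip div_eucl_of_nat //; case mp: (m %% p) => [|r] /=; last first.
  by exists m => //; right; rewrite dvdnn /dvdn mp.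
have [c cE H] := IH (m %/ p); exists c => //.
case: H => [->|[cm pc]]; [by left|right; split=> //].
by apply: dvdn_trans cm _; apply: dvdn_div; rewrite /dvdn mp.
Qed.

Definition smooth (m : N) : bool := (foldl (fun m p => strip 45 p m) m primes_lt61 =? 1)%num.

Lemma smoothP m : 0 < m -> ~~ smooth (N.of_nat m) ->
  exists p, [/\ prime p, 60 < p & p %| m].
Proof.
move=> m0; rewrite /smooth => nsm.
have [c cE H] : exists2 c, foldl (fun m p => strip 45 p m) (N.of_nat m) primes_lt61 = N.of_nat c &
    c = 1 \/ c %| m /\ forall p, N.of_nat p \in primes_lt61 -> ~~ (p %| c).
  have : all (fun p => 0 < N.to_nat p) primes_lt61 by [].
  elim/last_ind: primes_lt61 => [|ps p IH]; first by exists m => //; right.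
  rewrite all_rcons => /andP[p0 /IH[c cE H]].
  rewrite foldl_rcons cE -[p]N2Nat.id.
  have [d dE Hd] := stripP 45 c p0; exists d => //.
  case: Hd => [->|[dc pd]]; [by left|].
  case: H => [c1|[cm Hc]].
    by left; apply/eqP; rewrite -dvdn1 -c1.
  right; split=> [|r]; first exact: dvdn_trans dc cm.
  rewrite mem_rcons inE => /orP[/eqP rp|/Hc].
    by rewrite (Nat2N.inj _ _ rp).
  by apply: contra => /dvdn_trans; apply.
move: nsm; rewrite cE => c1.
have {}c1 : c <> 1 by move=> cE1; rewrite cE1 in c1.
case: H => // -[cm H]; exists (pdiv c).
have c2 : 1 < c by have := dvdn_gt0 m0 cm; move: c1; clear; lia.
have pp := pdiv_prime c2; split=> //; last exact: dvdn_trans (pdiv_dvd c) cm.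
rewrite ltnNge; apply/negP => le60; have := H (pdiv c).
by rewrite -primes_lt61P ?ltnS // pp pdiv_dvd => /(_ isT).
Qed.

(** A prime [p > 60] dividing [n - i] would give [n %% p = i < k = k %% p], and [i + s < p] excludes
    a carry. *)
Lemma compat_smooth n s k i : s <= 30 -> compat n s k -> 0 < i < k -> k <= 30 ->
  i < n -> smooth (N.of_nat (n - i)).
Proof.
move=> s30 cp /andP[i0 ik] k30 iltn; apply: contraT => ns.
have [p [pp p60 pd]] : exists p, [/\ prime p, 60 < p & p %| n - i].
  by apply: smoothP => //; rewrite subn_gt0.
have nE : n %% p = i.
  rewrite -(subnK (ltnW iltn)) -modnDml (eqP pd) add0n modn_small //.
  by move: ik k30 p60; clear; lia.
have := compat_prime cp pp; rewrite nE modn_small; last by move: k30 p60; clear; lia.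
move=> h; have : k <= i by apply: h; move: ik k30 s30 p60; clear; lia.
by rewrite leqNgt ik.
Qed.

(** By [compat_smooth], the first [i] for which [n - i] is not smooth bounds [k]. *)
Fixpoint degree_bound (fuel : nat) (n i : N) : N :=
  if fuel is f.+1 then
    if smooth (n - i) then degree_bound f n (i + 1)%num else i
  else 30%num.

Lemma degree_boundP n s k fuel i : s <= 30 -> compat n s k -> k <= 30 -> k <= n ->
  0 < i -> (N.of_nat k <= degree_bound fuel (N.of_nat n) (N.of_nat i))%num.
Proof.
move=> s30 cp k30 kn; elim: fuel i => [|f IH] i i0; first by move: k30; clear; rewrite /=; lia.
rewrite /degree_bound -/degree_bound.
have -> : (N.of_nat n - N.of_nat i = N.of_nat (n - i))%num by clear; lia.
have -> : (N.of_nat i + 1 = N.of_nat i.+1)%num by clear; lia.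
case: ifP => [_|/negbT ns]; first exact: IH.
case: (leqP k i) => [|ik]; first by clear; lia.
case/negP: ns; apply: compat_smooth cp _ _ _ => //; first by rewrite i0.
exact: leq_trans ik kn.
Qed.

Definition force (p n F : N) : N :=
  let pp := (p * p)%num in let r := (n mod pp)%num in
  if (r + 30 <? pp)%num && (r mod p =? 0)%num then (F * p)%num else F.

(** Accumulates primes that must divide [k] by [compat_dvd_sqr]; a product above 30 already excludes
    every [k <= 30]. *)
Fixpoint forced_factor (ps : seq N) (n F : N) : N :=
  if ps is p :: ps' then
    let F' := force p n F in
    if (30 <? F')%num then F' else forced_factor ps' n F'
  else F.

Lemma forced_factorP ps n s k F : s <= 30 -> compat n s k ->
    all (fun p => let p := N.to_nat p in prime p && (30 < p ^ 2)) ps -> uniq ps ->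
    N.to_nat F %| k -> all (fun p => coprime (N.to_nat p) (N.to_nat F)) ps ->
  N.to_nat (forced_factor ps (N.of_nat n) F) %| k.
Proof.
move=> s30 cp; elim: ps F => [|p ps IH] F //=.
move=> /andP[/andP[pp p30] ppr] /andP[pps ups] Fk /andP[cpF cF].
set F' := force p _ F.
have : N.to_nat F' %| k /\ all (fun p => coprime (N.to_nat p) (N.to_nat F')) ps.
  rewrite /F' /force; case: ifP => [/andP[h1 h2]|_]; last by split.
  rewrite N2Nat.inj_mul -/(muln _ _); split.
    rewrite Gauss_dvd 1?coprime_sym // Fk /=.
    have pE : p = N.of_nat (N.to_nat p) by rewrite N2Nat.id.
    move: h1 h2; rewrite pE -of_natM mulnn !of_nat_mod Nat2N.id => h1 h2.
    have pn : N.to_nat p %| n.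
      rewrite /dvdn -(modn_dvdm n (dvdn_exp (isT : 0 < 2) (dvdnn (N.to_nat p)))).
      by move: h2; clear; lia.
    apply: compat_dvd_sqr cp pp p30 pn _ => //.
    by move: h1; clear; lia.
  apply/allP => q qps; rewrite coprimeMr (allP cF q qps) /=.
  have /andP[qq _] := allP ppr q qps.
  rewrite prime_coprime // dvdn_prime2 //; apply: contra pps => /eqP/N2Nat.inj <-.
  exact: qps.
case=> F'k cF'; case: ifP => // _; exact: IH.
Qed.

Definition primes_7_29 := [:: 29; 23; 19; 17; 13; 11; 7]%num.

Definition odd_primes := [:: 3; 5; 7; 11; 13; 17; 19; 23; 29]%num.

(* The primes are only candidates; [3861] is treated apart to save time. *)
Definition newton_primes (n s : N) : seq N :=
  if (n =? 3861)%num then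
    if (s =? 27)%num then [:: 7]%num else if (s =? 30)%num then [:: 3]%num else [:: 11]%num
  else [:: 3; 5; 2; 7; 11; 13; 19; 23]%num.

(* Under call-by-value, unlike [has], this stops at the first success. *)
Fixpoint has_if (T : Type) (a : pred T) (l : seq T) : bool :=
  if l is x :: l' then if a x then true else has_if a l' else false.

Lemma has_ifE (T : Type) (a : pred T) l : has_if a l = has a l.
Proof. by elim: l => //= x l ->. Qed.

Definition no_linear_factor (n s : N) : bool :=
  if has_if (fun p => if n mod p =? 0 then nocarryN p n s else false)%num odd_primes then true
  else if has_if (fun p => newton_check n s p 1) (newton_primes n s) then true
  else ((n =? 3) && (s =? 26))%num.

Definition no_factor_of_degree (n k s : N) (ps : seq N) : bool :=
  if has_if (fun p => nocarryN p n s) ps then true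
  else has_if (fun p => newton_check n s p k) (newton_primes n s).

Definition range (a b : nat) : seq N := [seq N.of_nat i | i <- iota a b].

(** Degree 1 is settled by positivity for even [n], by a forced divisor [F > 1], or for each [s].
    Higher degrees are restricted to multiples of [F] up to [degree_bound]. In [ps] are the primes
    whose digits exclude [k] when no carry occurs; if [n %% p + 30 < p] for one of them, all [s] are
    settled at once. *)
Definition no_factor (n : N) : bool :=
  if (n <? 2)%num then true else
  let F := forced_factor primes_7_29 n 1 in
  if (30 <? F)%num then true else
  if (if N.even n then true else if (1 <? F)%num then true
      else all (no_linear_factor n) (range 1 30)) then
    let b := degree_bound 29 n 1 in
    all (fun k =>
      if (b <? k)%num then true else if (n <? 2 * k)%num then true
      else if (k mod F =? 0)%num then
        let ps := [seq p <- primes_lt61 | exceedsb 6 p n k p] in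
        if has_if (fun p => (n mod p + 30 <? p)%num) ps then true
        else all (fun s => no_factor_of_degree n k s ps) (range 1 30)
      else true) (range 2 29)
  else false.

Lemma no_factor_ok : all_products prime_powers 1 no_factor.
Proof. by vm_compute. Qed.

Lemma mem_range a b i : (N.of_nat i \in range a b) = (a <= i < a + b).
Proof.
by rewrite mem_map ?mem_iota //; exact: Nat2N.inj.
Qed.

Section NoFactor.
Variables (n s k : nat) (f g : {poly int}).
Hypotheses (s_range : 0 < s <= 30) (fgE : gpoly n s = (f * g)%R).
Hypothesis degE : (size f).-1 = k.

Lemma factor_compat : compat n s k.
Proof. by move=> p pp nc t; rewrite -degE; apply: factor_deg_mod fgE nc t. Qed.

Lemma newton_primes_prime p : p \in newton_primes (N.of_nat n) (N.of_nat s) ->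
  prime (N.to_nat p).
Proof.
have prs : all (fun p => prime (N.to_nat p)) [:: 3; 5; 2; 7; 11; 13; 19; 23]%num by [].
rewrite /newton_primes; case: ifP => _; last by apply: (allP prs).
by case: ifP => _; [|case: ifP => _]; rewrite mem_seq1 => /eqP->.
Qed.

Lemma has_newton_check :
  ~ has (fun p => newton_check (N.of_nat n) (N.of_nat s) p (N.of_nat k))
      (newton_primes (N.of_nat n) (N.of_nat s)).
Proof.
case/hasP=> p /newton_primes_prime pp; rewrite -[p]N2Nat.id => h.
exact: (newton_checkP pp h fgE degE).
Qed.

Lemma no_linear_factorP : k = 1 -> ~ no_linear_factor (N.of_nat n) (N.of_nat s).
Proof.
move=> k1; rewrite /no_linear_factor !has_ifE.
case: ifP => [/hasP[p pin]|_].
  have pp : prime (N.to_nat p).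
    have prs : all (fun p => prime (N.to_nat p)) odd_primes by [].
    exact: (allP prs).
  rewrite -[p]N2Nat.id; move: (N.to_nat p) pp => {pin}p pp.
  rewrite of_nat_mod; case: ifP => // pn /(nocarryNP (prime_gt0 pp)) nc _.
  have := factor_compat pp nc 1; rewrite k1 expn1 (modn_small (prime_gt1 pp)).
  by move: pn; clear; lia.
case: ifP => [h _|_ /andP[n3 s26]]; first by apply: has_newton_check; rewrite k1.
have [x] := linear_factor_root fgE (etrans degE k1).
have -> : n = 3 by move: n3; clear; lia.
have -> : s = 26 by move: s26; clear; lia.
by rewrite (negPf (gpoly_3_26_no_root x)).
Qed.

Lemma no_factor_of_degreeP : 1 < k <= 30 ->
  ~ no_factor_of_degree (N.of_nat n) (N.of_nat k) (N.of_nat s)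
      [seq p <- primes_lt61 | exceedsb 6 p (N.of_nat n) (N.of_nat k) p].
Proof.
move=> k_range; rewrite /no_factor_of_degree !has_ifE.
case: ifP => [|_]; last exact: has_newton_check.
case/hasP=> p; rewrite mem_filter -[p]N2Nat.id.
move: (N.to_nat p) => {}p /andP[ex pin] nc _.
have pp : prime p.
  have /allP/(_ _ pin) : all (fun p => prime (N.to_nat p)) primes_lt61 by [].
  by rewrite Nat2N.id.
have [|t] := @exceedsbP 6 p n k 1; first by rewrite expn1.
by rewrite ltnNge factor_compat //; exact: nocarryNP (prime_gt0 pp) nc.
Qed.

Lemma no_factorP : 0 < k <= 30 -> 2 * k <= n -> ~ no_factor (N.of_nat n).
Proof.
move=> k_range kn; have cp := factor_compat; have [s0 s30] := andP s_range.
have [k0 k30] := andP k_range.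
rewrite /no_factor; case: ifP => [|_]; first by move: k0 kn; clear; lia.
have := @forced_factorP primes_7_29 n s k 1 s30 cp isT isT (dvd1n k) _.
rewrite (_ : all _ _ = true) => [/(_ isT)|]; last by [].
move: (forced_factor _ _ _) => F Fk.
case: ifP => [F30 _|_].
  by have := dvdn_leq k0 Fk; move: F30 k30; clear; lia.
have s_in : N.of_nat s \in range 1 30 by rewrite mem_range.
case: ifP => // lin /allP deg.
have [k1|k_ge2] : k = 1 \/ 1 < k by move: k0; clear; lia.
  move: lin; rewrite k1 in Fk *; case: ifP => [n_even _|_].
    have [x] := linear_factor_root fgE (etrans degE k1).
    apply/negP/gpoly_no_root; have /N.even_spec[m mE] : is_true (N.even (N.of_nat n)) by [].
    have -> : n = (N.to_nat m).*2 by move: mE; clear; lia.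
    by rewrite odd_double.
  case: ifP => [F1 _|_ /allP/(_ _ s_in)]; last exact: no_linear_factorP.
  by move: Fk F1; rewrite dvdn1 => /eqP; clear; lia.
have k_in : N.of_nat k \in range 2 29 by rewrite mem_range; move: k_ge2 k30; clear; lia.
have k_le_n : k <= n by move: kn; clear; lia.
have /N.ltb_ge kb := @degree_boundP n s k 29 1 s30 cp k30 k_le_n isT.
move: (deg _ k_in); rewrite kb.
have -> : (N.of_nat n <? 2 * N.of_nat k)%num = false by move: kn; clear; lia.
have -> : (N.of_nat k mod F =? 0)%num by rewrite -[F]N2Nat.id of_nat_mod; move: Fk; clear; lia.
rewrite has_ifE; case: ifP => [/hasP[p]|_ /allP/(_ _ s_in)]; last first.
  by apply: no_factor_of_degreeP; rewrite k_ge2 k30.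
rewrite mem_filter -[p]N2Nat.id; move: (N.to_nat p) => {}p /andP[ex pin].
have pp : prime p.
  have /allP/(_ _ pin) : all (fun p => prime (N.to_nat p)) primes_lt61 by [].
  by rewrite Nat2N.id.
rewrite of_nat_mod => np _.
have [|t] := @exceedsbP 6 p n k 1; first by rewrite expn1.
rewrite ltnNge (cp p pp _ t) //; apply: nocarry_of_mod => //.
by move: np s30; clear; lia.
Qed.
End NoFactor.

Theorem corollary1 (n s : nat) (hn : 1 <= n) (hs : 1 <= s <= 30)
    (hred : ~ irreducible_poly (g1 n s)) :
  (n, s) = (786600, 25) \/ (n, s) = (786600, 26).
Proof.
case: hred; apply: irreducible_g1 => // f g fgE k0; rewrite -mul2n => kn.
have cp : compat n s (size f).-1 by exact: factor_compat fgE erefl.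
have [k31|k30] := leqP (size f).-1 30.
  apply: (no_factorP hs fgE erefl _ kn); first by rewrite k0.
  have [s0 s30] := andP hs.
  apply: (all_products_prime_powers hn _ no_factor_ok) => p pp.
  by apply: (compat_pfactor_leq hs _ cp pp hn); rewrite k0.
have [big|small] := leqP (11 ^ 4) (size f).-1; first exact: not_compat_large hs kn big cp.
exact: not_compat_mid hs kn k30 (ltnW small) cp.
Qed.
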